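(* Let $\mathcal{K}$ be a complex separable Hilbert space and let $Q\in\mathcal{A}_{\mathcal{I}}(\mathcal{K})$ be an inner function with Fourier (operator) coefficients $\{Q_n\}_{n\geqslant0}$. The following statements are equivalent: (i) $\widehat{\rho(Q)}H^2_{\mathcal{K}}=\widehat{Q}H^2_{\mathcal{K}}$; (ii) there exists a unitary operator $A:\mathcal{K}\to\mathcal{K}$ such that $AQ_n=Q_nA=(AQ_n)^*$ for all $n\geqslant0$. Moreover, if $\dim(\mathcal{K})<\infty$, then (i) and (ii) are also equivalent to each of (iii) $\widehat{\rho(Q)}H^2_{\mathcal{K}}\subseteq\widehat{Q}H^2_{\mathcal{K}}$; (iv) $\widehat{Q}H^2_{\mathcal{K}}\subseteq\widehat{\rho(Q)}H^2_{\mathcal{K}}$.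
   Context: Let $\mathbb{T}$ be the unit circle with normalized Lebesgue measure and $H^2_{\mathcal{K}}\subseteq L^2(\mathbb{T},\mathcal{K})$ the Hardy space of square-integrable $\mathcal{K}$-valued functions whose Fourier coefficients of negative index vanish. For a measurable operator-valued function $Q:\mathbb{T}\to\mathcal{B}(\mathcal{K})$ with $\operatorname{ess\,sup}_{z\in\mathbb{T}}\|Q(z)\|<\infty$, define $\widehat{Q}:L^2(\mathbb{T},\mathcal{K})\to L^2(\mathbb{T},\mathcal{K})$ by $(\widehat{Q}f)(z)=Q(z)f(z)$ for a.e. $z$. $Q$ is analytic if $\widehat{Q}(H^2_{\mathcal{K}})\subseteq H^2_{\mathcal{K}}$; $\mathcal{A}(\mathcal{K})$ denotes the set of analytic functions. $Q\in\mathcal{A}(\mathcal{K})$ is inner if $Q(z)$ is a unitary operator on $\mathcal{K}$ for almost every $z\in\mathbb{T}$; $\mathcal{A}_{\mathcal{I}}(\mathcal{K})$ denotes the set of inner functions. For $Q\in\mathcal{A}(\mathcal{K})$ and $n\geqslant0$, the $n$-th Fourier coefficient $Q_n\in\mathcal{B}(\mathcal{K})$ is defined by letting $Q_nv$ be the $n$-th Fourier coefficient of $\widehat{Q}v$ ($v\in\mathcal{K}$ regarded as a constant function), so that $Q(z)v=\sum_{n\geqslant0}z^nQ_nv$ in $L^2(\mathbb{T},\mathcal{K})$. The map $\rho:\mathcal{A}(\mathcal{K})\to\mathcal{A}(\mathcal{K})$ is given by $\rho(Q)(z)=Q(\overline{z})^*$ for a.e. $z\in\mathbb{T}$; it maps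 inner functions to inner functions. *)

(* Defs.v *)
From HB Require Import structures.
From mathcomp Require Import all_boot all_order all_algebra.
From mathcomp Require Import complex ring lra.
From mathcomp Require Import all_classical all_reals all_analysis measurable_realfun ess_sup_inf.

Set Implicit Arguments.
Unset Strict Implicit.
Unset Printing Implicit Defensive.

Import Order.TTheory GRing.Theory Num.Theory.
Import numFieldNormedType.Exports.

Local Open Scope classical_set_scope.
Local Open Scope complex_scope.
Local Open Scope ring_scope.

(* {dot K for @conjc R}: linear in the first argument, conjugate-linear in the
   second. *)
HB.mixin Record isHilbert (R : realType) K of CompleteNormedModule R[i] K := {
  dot : {dot K for @conjc R} ;
  normr2_dot : forall x : K, `|x| ^+ 2 = dot x x
}.

#[short(type="hilbertType")]
HB.structure Definition Hilbert (R : realType) :=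
  {K of CompleteNormedModule R[i] K & isHilbert R K}.

Section HilbertTheory.
Context {R : realType} {K : hilbertType R}.
Implicit Types (x y z u v : K) (a : R[i]) (t : R).

Definition hnorm x : R := complex.Re `|x|.

Lemma hnormE x : `|x| = (hnorm x)%:C.
Proof. by rewrite /hnorm RRe_real// normr_real. Qed.

Lemma hnorm_ge0 x : 0 <= hnorm x.
Proof. by rewrite -ler0c -hnormE normr_ge0. Qed.

Lemma hnorm_eq0 x : hnorm x = 0 -> x = 0.
Proof. by move=> x0; apply/normr0_eq0; rewrite hnormE x0. Qed.

Lemma dotC x y : dot x y = (dot y x)^*.
Proof. by rewrite (hermC dot x y) expr0 mul1r. Qed.

Lemma dotDl x y z : dot (x + y) z = dot x z + dot y z.
Proof. exact: linearDl. Qed.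
Lemma dotDr x y z : dot x (y + z) = dot x y + dot x z.
Proof. exact: linearDr. Qed.
Lemma dotNl x y : dot (- x) y = - dot x y.
Proof. exact: linearNl. Qed.
Lemma dotNr x y : dot x (- y) = - dot x y.
Proof. exact: linearNr. Qed.
Lemma dotZl a x y : dot (a *: x) y = a * dot x y.
Proof. by rewrite linearZl_LR. Qed.
Lemma dotZr a x y : dot x (a *: y) = a^* * dot x y.
Proof. by rewrite dotC dotZl rmorphM /= -dotC. Qed.

Let rdot x y : R := complex.Re (dot x y).

Let ReD (a b : R[i]) : complex.Re (a + b) = complex.Re a + complex.Re b.
Proof. by case: a b => ? ? []. Qed.
Let ReN (a : R[i]) : complex.Re (- a) = - complex.Re a.
Proof. by case: a. Qed.
Let ReZ t (a : R[i]) : complex.Re (t%:C * a) = t * complex.Re a.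
Proof. by case: a => b c /=; rewrite mul0r subr0. Qed.

Let rdotxx x : rdot x x = hnorm x ^+ 2.
Proof. by rewrite /rdot -normr2_dot hnormE -rmorphXn. Qed.

Let rdotC x y : rdot x y = rdot y x.
Proof. by rewrite /rdot dotC; case: (dot y x). Qed.
Let rdotDl x y z : rdot (x + y) z = rdot x z + rdot y z.
Proof. by rewrite /rdot dotDl ReD. Qed.
Let rdotDr x y z : rdot x (y + z) = rdot x y + rdot x z.
Proof. by rewrite /rdot dotDr ReD. Qed.
Let rdotNl x y : rdot (- x) y = - rdot x y.
Proof. by rewrite /rdot dotNl ReN. Qed.
Let rdotNr x y : rdot x (- y) = - rdot x y.
Proof. by rewrite /rdot dotNr ReN. Qed.
Let rdotZl t x y : rdot (t%:C *: x) y = t * rdot x y.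
Proof. by rewrite /rdot dotZl ReZ. Qed.
Let rdotZr t x y : rdot x (t%:C *: y) = t * rdot x y.
Proof. by rewrite rdotC rdotZl rdotC. Qed.
Let rdotE := (rdotDl, rdotDr, rdotNl, rdotNr, rdotZl, rdotZr).

Lemma Re_dot_le x y : complex.Re (dot x y) <= hnorm x * hnorm y.
Proof.
have [x0|x0] := eqVneq (hnorm x) 0.
  by rewrite (hnorm_eq0 x0) -(scale0r x) dotZl mul0r scale0r mulr_ge0 ?hnorm_ge0.
have [y0|y0] := eqVneq (hnorm y) 0.
  by rewrite (hnorm_eq0 y0) dotC -(scale0r y) dotZl mul0r rmorph0 mulr_ge0 ?hnorm_ge0.
have xp : 0 < hnorm x by rewrite lt_neqAle eq_sym x0 hnorm_ge0.
have yp : 0 < hnorm y by rewrite lt_neqAle eq_sym y0 hnorm_ge0.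
set z := (hnorm y)%:C *: x - (hnorm x)%:C *: y.
have : 0 <= rdot z z by rewrite rdotxx sqr_ge0.
rewrite /z !rdotE !rdotxx (rdotC y x) -/(rdot x y) => h.
have : 0 <= (hnorm x * hnorm y) * (hnorm x * hnorm y - rdot x y) by lra.
by rewrite pmulr_rge0 ?mulr_gt0// subr_ge0.
Qed.

Lemma dot_inj u v : (forall x, dot x u = dot x v) -> u = v.
Proof.
move=> uv; apply/eqP; rewrite -subr_eq0; apply/eqP/hnorm_eq0.
apply/eqP; rewrite -sqrf_eq0 -rdotxx /rdot.
by rewrite dotDr dotNr uv subrr.
Qed.

Lemma riesz (phi : {linear K -> R[i]^o}) (M : R) :
  (forall x, complex.Re (phi x) <= M * hnorm x) ->
  exists u, forall x, phi x = dot x u.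
Proof.
move=> phiM; pose f x := complex.Re (phi x).
pose J x := rdot x x - 2 * f x.
have fD x y : f (x + y) = f x + f y by rewrite /f linearD ReD.
have fZ t x : f (t%:C *: x) = t * f x.
  by rewrite /f linearZ/= ReZ.
pose A := range J.
have lbA : lbound A (- M ^+ 2).
  move=> _ [x _ <-]; rewrite /J rdotxx.
  have := phiM x; rewrite -/(f x) => h.
  have : 0 <= (hnorm x - M) ^+ 2 by rewrite sqr_ge0.
  lra.
have hA : has_inf A by split; [exists (J 0); exists 0|exists (- M ^+ 2)].
pose d := inf A.
have dJ x : d <= J x by apply: ge_inf; [exact: hA.2|exists x].
have ex n : exists x, J x < d + n.+1%:R^-1.
  have [_ [x _ <-] h] := @inf_adherent _ A n.+1%:R^-1 (ltac:(by [])) hA.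
  by exists x.
pose u_ n := xget 0 [set x | J x < d + n.+1%:R^-1].
have uJ n : J (u_ n) < d + n.+1%:R^-1.
  by have [x xP] := ex n; exact: (xgetPex 0 (ex n)).
have par x y : rdot (x - y) (x - y) <= 2 * (J x + J y - 2 * d).
  have h : J x + J y - 2 * J ((2^-1)%:C *: (x + y)) = rdot (x - y) (x - y) / 2.
    by rewrite /J fZ fD !rdotE (rdotC y x); field.
  have := dJ ((2^-1)%:C *: (x + y)); lra.
have invS (e : R) : 0 < e -> exists N : nat, N.+1%:R^-1 < e.
  by move=> e0; have [k] := ltr_add_invr e0; rewrite add0r; exists k.
have invW (m n : nat) : (m <= n)%N -> n.+1%:R^-1 <= m.+1%:R^-1 :> R.
  by move=> mn; rewrite lef_pV2 ?posrE// ler_nat ltnS.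
have /cvg_ex[u uP] : cvg (u_ n @[n --> \oo]).
  apply/cauchy_cvgP/cauchyP => e e0.
  have eE : e = (complex.Re e)%:C by rewrite RRe_real// gtr0_real.
  have e0' : 0 < complex.Re e by rewrite -ltcR -eE.
  have [N NP] := invS ((complex.Re e) ^+ 2 / 4) (ltac:(by rewrite divr_gt0 ?exprn_gt0)).
  exists (u_ N); exists N => // n /= Nn.
  rewrite -ball_normE/= hnormE eE ltcR -(@ltr_pXn2r _ 2)// ?nnegrE ?hnorm_ge0 ?ltW//.
  rewrite -rdotxx; apply: (le_lt_trans (par _ _)).
  move: (uJ N) (uJ n) (invW _ _ Nn) NP; move: (J _) (J _) (_^-1) (_^-1) (complex.Re e).
  move=> a b c c' g; lra.
have key x : f x = rdot x u.
  apply/eqP; rewrite -subr_eq0 -normr_le0; apply/ler_addgt0Pr => e e0.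
  pose C := hnorm x + (hnorm x ^+ 2 + 1) / 2.
  have C0 : 0 < C.
    by rewrite ltr_wpDl ?hnorm_ge0// divr_gt0// ltr_wpDl ?sqr_ge0.
  pose t := e / C; have t0 : 0 < t by rewrite divr_gt0.
  have eE : e = t * C by rewrite divfK ?gt_eqF.
  have [N1 N1P] := invS (t ^+ 2) (ltac:(by rewrite exprn_gt0)).
  have [N2 _ N2P] : \forall n \near \oo, `|u - u_ n| < t%:C.
    by move/cvgrPdist_lt: uP; apply; rewrite ltcR.
  pose n := maxn N1 N2.
  have nt : hnorm (u - u_ n) < t.
    by rewrite -ltcR -hnormE; apply: N2P; rewrite /= leq_maxr.
  have Jn : J (u_ n) < d + t ^+ 2.
    apply: (lt_trans (uJ n)); rewrite ltrD2l.
    exact: le_lt_trans (invW _ _ (leq_maxl _ _)) N1P.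
  have var s : 0 <= t ^+ 2 + 2 * s * (rdot x (u_ n) - f x) + s ^+ 2 * hnorm x ^+ 2.
    have := dJ (u_ n + s%:C *: x); move: Jn.
    rewrite /J fD fZ !rdotE (rdotC _ x) !rdotxx; lra.
  have h1 := var t; have h2 := var (- t).
  have {}h1 : 0 <= t * (t + 2 * (rdot x (u_ n) - f x) + t * hnorm x ^+ 2) by lra.
  have {}h2 : 0 <= t * (t - 2 * (rdot x (u_ n) - f x) + t * hnorm x ^+ 2) by lra.
  move: h1 h2; rewrite !pmulr_rge0// => h1 h2.
  have h3 := Re_dot_le x (u - u_ n); have h4 := Re_dot_le (- x) (u - u_ n).
  have hN : hnorm (- x) = hnorm x by rewrite /hnorm normrN.
  rewrite hN -/(rdot _ _) !rdotE in h4; rewrite -/(rdot _ _) !rdotE in h3.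
  have h5 : hnorm x * hnorm (u - u_ n) <= hnorm x * t.
    by rewrite ler_wpM2l ?hnorm_ge0// ltW.
  rewrite eE /C add0r ler_norml; apply/andP; split; lra.
exists u => x; have := key x; have := key ('i *: x).
rewrite /f /rdot linearZ/= dotZl.
case: (phi x) => a b; case: (dot x u) => a' b' /=.
by rewrite !mul0r !mul1r !sub0r => /oppr_inj -> ->.
Qed.

End HilbertTheory.

Section BoundedOperators.
Context {R : realType}.

Record bop (K : hilbertType R) :=
  Bop { bop_fun :> {linear K -> K} ; bop_continuous : continuous bop_fun }.

Context {K : hilbertType R}.
Implicit Types (A B : bop K) (x y : K).

Lemma bop_ext A B : A =1 B -> A = B.
Proof.
case: A B => [f cf] [g cg] /= fg.
have {}fg : f = g.
  move: f g {cf cg} fg => [f cf] [g cg] /= /funext fg.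
  move: cf cg; rewrite fg => cf cg; congr (GRing.Linear.Pack _).
  move: cf cg => [[cf1] [cf2]] [[cg1] [cg2]].
  by rewrite (Prop_irrelevance cf1 cg1) (Prop_irrelevance cf2 cg2).
move: cf cg; rewrite fg => cf cg; congr Bop; exact: Prop_irrelevance.
Qed.

Definition bop_id : bop K := @Bop K idfun (fun x => cvg_id).

Lemma bop_comp_continuous A B : continuous (A \o B).
Proof.
by move=> x; apply: continuous_comp; [exact: bop_continuous|exact: bop_continuous].
Qed.

Definition bop_comp A B : bop K := @Bop K (A \o B) (@bop_comp_continuous A B).

Lemma bop_bounded A : exists2 M : R, 0 <= M & forall x, hnorm (A x) <= M * hnorm x.
Proof.
have /linear_boundedP := (linear_bounded_continuous _).2 (@bop_continuous K A).
move=> /pinfty_ex_gt0[M M0 MP].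
have ME : M = (complex.Re M)%:C by rewrite RRe_real// gtr0_real.
exists (complex.Re M); first by rewrite -ler0c -ME ltW.
by move=> x; have := MP x; rewrite ME !hnormE -rmorphM lecR.
Qed.

Lemma adj_exists A : exists B, forall x y, dot (A x) y = dot x (B y).
Proof.
have [M M0 MP] := bop_bounded A.
have ex y : exists u, forall x, dot (A x) y = dot x u.
  have lphi : linear (fun x => dot (A x) y : R[i]^o).
    by move=> a u v; rewrite linearP/= dotDl dotZl.
  pose phi : {linear K -> R[i]^o} := HB.pack (fun x => dot (A x) y : R[i]^o)
    (GRing.isLinear.Build _ _ _ _ _ lphi).
  apply: (@riesz _ _ phi (M * hnorm y)) => x /=.
  by rewrite (le_trans (Re_dot_le _ _))// mulrAC ler_wpM2r ?hnorm_ge0.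
have [B BP] := choice ex.
have lB : linear B.
  move=> a u v; apply: dot_inj => x.
  by rewrite -BP !dotDr !dotZr !BP.
pose B' : {linear K -> K} := HB.pack B (GRing.isLinear.Build _ _ _ _ _ lB).
suff cB : continuous B' by exists (@Bop K B' cB).
apply/bounded_linear_continuous/linear_boundedP.
near=> r => x /=.
have B2 : hnorm (B x) ^+ 2 <= M * hnorm x * hnorm (B x).
  have -> : hnorm (B x) ^+ 2 = complex.Re (dot (B x) (B x)).
    by rewrite -normr2_dot hnormE -rmorphXn.
  rewrite -BP (le_trans (Re_dot_le _ _))// mulrAC ler_wpM2r ?hnorm_ge0//.
have BM : hnorm (B x) <= M * hnorm x.
  have [->|b0] := eqVneq (hnorm (B x)) 0; first by rewrite mulr_ge0 ?hnorm_ge0.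
  by rewrite -(@ler_pM2r _ (hnorm (B x))) -?expr2// lt_neqAle eq_sym b0 hnorm_ge0.
rewrite !hnormE (@le_trans _ _ (M%:C * (hnorm x)%:C))//.
  by rewrite -rmorphM lecR.
by rewrite ler_wpM2r ?ler0c ?hnorm_ge0//; near: r; apply: nbhs_pinfty_ge; rewrite ger0_real ?ler0c.
Unshelve. all: by end_near. Qed.

Definition adj A : bop K := projT1 (cid (adj_exists A)).

Lemma adjP A x y : dot (A x) y = dot x (adj A y).
Proof. by rewrite /adj; case: cid. Qed.

Definition unitary A := bop_comp (adj A) A = bop_id /\ bop_comp A (adj A) = bop_id.

Definition opnorm A : R := sup [set hnorm (A x) | x in [set x | hnorm x <= 1]].

End BoundedOperators.

Definition circle (R : realType) := {z : R[i] | `|z| == 1}.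

Section Circle.
Context {R : realType}.

HB.instance Definition _ := Choice.on (circle R).

Lemma circle1_subproof : `|1 : R[i]| == 1. Proof. by rewrite normr1. Qed.
HB.instance Definition _ :=
  isPointed.Build (circle R) (exist _ 1 circle1_subproof).

Definition circle_coord (z : circle R) : R * R :=
  (complex.Re (val z), complex.Im (val z)).

(* The Borel sets of the circle: the traces of the Borel sets of the plane. *)
HB.instance Definition _ := Measurable.copy (circle R)
  (g_sigma_algebra_preimageType circle_coord).

Lemma circle_exp_subproof (t : R) :
  `|cos (2 * pi * t) +i* sin (2 * pi * t)| == 1.
Proof. by rewrite normc_def/= cos2Dsin2 sqrtr1. Qed.

Definition circle_exp (t : R) : circle R := 
  exist (fun z : R[i] => `|z| == 1) _ (circle_exp_subproof t).

Lemma measurable_circle_exp :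
  measurable_fun [set: measurableTypeR R] circle_exp.
Proof.
move=> _ _ [B mB <-]; rewrite !setTI -comp_preimage.
rewrite -[X in measurable X]setTI.
suff : measurable_fun [set: R] (circle_coord \o circle_exp) by apply.
apply: measurable_fun_pair => /=.
  apply: (@measurableT_comp _ _ _ _ _ _ (@cos R)).
    exact: continuous_measurable_fun (@continuous_cos R).
  exact: measurable_funM.
apply: (@measurableT_comp _ _ _ _ _ _ (@sin R)).
  exact: continuous_measurable_fun (@continuous_sin R).
exact: measurable_funM.
Qed.

HB.instance Definition _ := isMeasurableFun.Build _ _ (measurableTypeR R) _
  (circle_exp : measurableTypeR R -> circle R) measurable_circle_exp.

(* Normalized Lebesgue measure: the law of e^(2 i pi t), t uniform in [0, 1]. *)
Definition circle_measure : probability (circle R) R :=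
  distribution (uniform_prob (@ltr01 R)) circle_exp.

Definition cintegral (g : circle R -> R[i]) : R[i] :=
  (\int[circle_measure]_z complex.Re (g z)) +i*
  (\int[circle_measure]_z complex.Im (g z)).

Lemma circle_conj_subproof (z : circle R) : `|(val z)^*| == 1.
Proof.
by case: z => -[a b] /= /eqP; rewrite !normc_def/= sqrrN => ->.
Qed.

Definition circle_conj (z : circle R) : circle R :=
  exist (fun w : R[i] => `|w| == 1) _ (circle_conj_subproof z).

End Circle.

Section HardySpace.
Context {R : realType} {K : hilbertType R}.
Implicit Types (f g : circle R -> K) (Q : circle R -> bop K).

Definition borel_measurable f :=
  measurable_fun [set: circle R] (f : circle R -> g_sigma_algebraType (@open K)).

(* Subsets of L^2(T, K) are represented by the sets of all the functions whose
   almost-everywhere class they contain. *)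
Definition L2 : set (circle R -> K) :=
  [set f | borel_measurable f /\
    (\int[circle_measure]_z (hnorm (f z) ^+ 2)%:E < +oo)%E].

(* v is the n-th Fourier coefficient of f, the K-valued integral of
   z^(-n) f(z) being understood weakly. *)
Definition is_fourier_coef f (n : int) (v : K) :=
  forall w, dot v w = cintegral (fun z => val z ^ (- n) * dot (f z) w).

Definition hardy : set (circle R -> K) :=
  [set f | L2 f /\ forall n : int, n < 0 -> is_fourier_coef f n 0].

(* The image of S under the multiplication operator f |-> Q f. *)
Definition mulop_image Q (S : set (circle R -> K)) : set (circle R -> K) :=
  [set g | L2 g /\
    exists2 f, S f & \forall z \ae circle_measure, g z = Q z (f z)].

(* K being separable, B(K)-valued functions are measurable in the strong
   (equivalently, weak) sense. *)
Definition bounded_measurable Q :=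
  (forall v, borel_measurable (fun z => Q z v)) /\
  (ess_sup circle_measure (fun z => (opnorm (Q z))%:E) < +oo)%E.

Definition analytic Q :=
  bounded_measurable Q /\ mulop_image Q hardy `<=` hardy.

Definition inner_function Q :=
  analytic Q /\ \forall z \ae circle_measure, unitary (Q z).

Definition fourier_coefs Q (Qn : nat -> bop K) :=
  forall n v, is_fourier_coef (fun z => Q z v) n%:Z (Qn n v).

Definition rho Q : circle R -> bop K := fun z => adj (Q (circle_conj z)).

End HardySpace.

Definition separable (T : topologicalType) :=
  exists2 D : set T, countable D & dense D.

Definition finite_dimensional (R : realType) (K : hilbertType R) :=
  exists (n : nat) (e : 'I_n -> K),
    forall v, exists c : 'I_n -> R[i], v = \sum_i c i *: e i.

(* Main.v *)
Require Import Defs.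
From HB Require Import structures.
From mathcomp Require Import all_boot all_order all_algebra.
From mathcomp Require Import complex ring lra zify.
From mathcomp Require Import all_classical all_reals all_analysis measurable_realfun.
Set Implicit Arguments.
Unset Strict Implicit.
Unset Printing Implicit Defensive.
Import Order.TTheory GRing.Theory Num.Theory.
Import numFieldNormedType.Exports.
Local Open Scope classical_set_scope.
Local Open Scope complex_scope.
Local Open Scope ring_scope.

(** Write adj for adjoints and Q~ for rho Q. Everything is reduced to one
    condition on the Fourier coefficients:

      (T)  there is a unitary U with adj Q_n = Q_n U for all n.

    (T) is equivalent to (ii) ([selfadjoint_twist]). If A is as in (ii), take
    U = A^2. Conversely, taking adjoints in (T) shows that U commutes with
    every Q_n; a unitary square root A of U that commutes with the whole
    commutant of U does the job, since
    adj (A Q_n) = Q_n U (adj A) = Q_n A. Such a root is built without the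
    spectral theorem ([unitary_sqrt]): with C and S the real and imaginary
    parts of U, put A = c + i J d with the half-angle operators
    c = sqrt((1+C)/2), d = sqrt((1-C)/2) and J a symmetry correcting the sign
    of d; the roots and J are strong limits of polynomials.

    (T) implies (i): the coefficients of Q~ are the adj Q_n, so Q~ and Q U have
    the same Fourier coefficients, hence agree almost everywhere, and U maps
    the Hardy space onto itself ([twist_image_eq]).

    (i) implies (T): the unitary-valued function W = (adj Q) Q~ and its
    adjoint both map constants into the Hardy space, so that each <W v, w> has
    its only Fourier coefficient at 0. Hence W is almost everywhere a constant
    U, and Q~ = Q U ([image_eq_twist]).

    In finite dimension the inclusion (iii) suffices ([image_sub_twist]). Now
    only W v is known to be in the Hardy space. By strong induction on n,
    (adj W)(adj Q_n) is the constant Q_n: the product formula for Q~ = Q W and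
    the induction hypothesis show that the mean of (adj W)(adj Q_n) x is Q_n x,
    so that |adj Q_n x|^2 - |Q_n x|^2 is a variance, hence nonnegative; summed
    over an orthonormal basis these variances vanish, because an operator and
    its adjoint have the same Hilbert-Schmidt norm. Evaluating W at one good
    point gives U. The inclusion (iv) is (iii) for Q~, which is again analytic:
    on matrix entries rho is f(z) |-> conj (f (conj z)), and this preserves
    scalar Hardy functions ([analytic_unitary_rho]).

    The analytic input is the uniqueness of Fourier coefficients
    ([fourier_uniqueness]), obtained from a monotone-class argument, and the
    equivalence of weak and Borel measurability in a separable space
    ([wmeasurable_borel]). *)

Local Notation Re := complex.Re.
Local Notation Im := complex.Im.

(** * Real and imaginary parts *)

Section ComplexCoordinates.
Context {R : realType}.
Implicit Types (t : R) (a b x y : R[i]).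

Lemma ReD a b : Re (a + b) = Re a + Re b.
Proof. exact: raddfD. Qed.

Lemma conj_realC t : (t%:C : R[i])^* = t%:C.
Proof. exact: conjc_real. Qed.

Lemma realCV2 : (2^-1)%:C = 2^-1 :> R[i].
Proof. by rewrite fmorphV rmorph_nat. Qed.

Lemma conjV2 : ((2^-1 : R[i])^*) = 2^-1.
Proof. by rewrite -realCV2 conj_realC. Qed.

Lemma mulii : 'i * 'i = -1 :> R[i].
Proof. by rewrite -expr2 sqr_i. Qed.

Lemma conji : ('i : R[i])^* = - 'i.
Proof. by apply/eqP; rewrite eq_complex /= oppr0 !eqxx. Qed.

Lemma ReM (x y : R[i]) : Re (x * y) = Re x * Re y - Im x * Im y.
Proof. by case: x y => ? ? []. Qed.
Lemma ImM (x y : R[i]) : Im (x * y) = Re x * Im y + Im x * Re y.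
Proof. by case: x y => ? ? []. Qed.
Lemma ImD (x y : R[i]) : Im (x + y) = Im x + Im y.
Proof. by case: x y => ? ? []. Qed.
Lemma ReN (x : R[i]) : Re (- x) = - Re x. Proof. by case: x. Qed.
Lemma ImN (x : R[i]) : Im (- x) = - Im x. Proof. by case: x. Qed.
Lemma ReJ (x : R[i]) : Re x^* = Re x. Proof. by case: x. Qed.
Lemma ImJ (x : R[i]) : Im x^* = - Im x. Proof. by case: x. Qed.
Lemma complex_ext (x y : R[i]) : Re x = Re y -> Im x = Im y -> x = y.
Proof. by case: x y => ? ? [? ?] /= -> ->. Qed.

Lemma ReIm_norm_le1 (a : R[i]) : `|a| <= 1 -> `|Re a| <= 1 /\ `|Im a| <= 1.
Proof.
rewrite normc_def => h; have {h} : Num.sqrt (Re a ^+ 2 + Im a ^+ 2) <= 1 by rewrite -lecR.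
move=> h; split; apply: le_trans h; rewrite -sqrtr_sqr ler_wsqrtr// ?lerDl ?lerDr ?sqr_ge0//.
Qed.

Lemma Re_normc_le (a : R[i]) : Re `|a| <= `|Re a| + `|Im a|.
Proof.
rewrite normc_def /= -[leRHS]ger0_norm ?addr_ge0// -sqrtr_sqr ler_wsqrtr//.
rewrite -(real_normK (num_real (Re a))) -(real_normK (num_real (Im a))).
by move: (normr_ge0 (Re a)) (normr_ge0 (Im a)); move: `|_| `|_| => s t; nra.
Qed.

End ComplexCoordinates.

(** * Operators on a Hilbert space and their strong limits *)

Section Hilbert.
Context {R : realType} {K : hilbertType R}.
Implicit Types (x y z u v : K) (a : R[i]) (t : R) (A B : bop K).

Lemma sqr_hnorm x : hnorm x ^+ 2 = Re (dot x x).
Proof. by rewrite -normr2_dot hnormE -rmorphXn. Qed.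

Lemma dotxx x : dot x x = (hnorm x ^+ 2)%:C.
Proof. by rewrite -normr2_dot hnormE rmorphXn. Qed.

Lemma hnorm0 : hnorm (0 : K) = 0.
Proof. by rewrite /hnorm normr0. Qed.

Lemma hnormN x : hnorm (- x) = hnorm x.
Proof. by rewrite /hnorm normrN. Qed.

Lemma ler_hnormD x y : hnorm (x + y) <= hnorm x + hnorm y.
Proof. by rewrite -lecR rmorphD/= -!hnormE ler_normD. Qed.

Lemma ler_hnormB x y : hnorm (x - y) <= hnorm x + hnorm y.
Proof. by rewrite -(hnormN y) ler_hnormD. Qed.

Lemma hnormZ a x : hnorm (a *: x) = Re `|a| * hnorm x.
Proof.
have : `|a *: x| = `|a| * `|x| by rewrite normrZ.
rewrite !hnormE -{1}(@RRe_real _ `|a|) ?normr_real// -rmorphM.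
by move=> /complexI.
Qed.

Lemma hnormZr t x : hnorm (t%:C *: x) = `|t| * hnorm x.
Proof. by rewrite hnormZ normc_def/= expr0n/= addr0 sqrtr_sqr. Qed.

Lemma dot0l x : dot 0 x = 0. Proof. by rewrite -(scale0r 0) dotZl mul0r. Qed.
Lemma dot0r x : dot x 0 = 0. Proof. by rewrite dotC dot0l rmorph0. Qed.
Lemma dotBl x y z : dot (x - y) z = dot x z - dot y z.
Proof. by rewrite dotDl dotNl. Qed.
Lemma dotBr x y z : dot x (y - z) = dot x y - dot x z.
Proof. by rewrite dotDr dotNr. Qed.

Lemma dot_injl u v : (forall x, dot u x = dot v x) -> u = v.
Proof. by move=> uv; apply: dot_inj => x; rewrite dotC uv -dotC. Qed.

Lemma sqr_hnormD x y :
  hnorm (x + y) ^+ 2 = hnorm x ^+ 2 + 2 * Re (dot x y) + hnorm y ^+ 2.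
Proof.
rewrite !sqr_hnorm dotDl !dotDr (dotC y x) !raddfD /=.
by case: (dot x y) => a b /=; lra.
Qed.

Lemma sqr_hnormB x y :
  hnorm (x - y) ^+ 2 = hnorm x ^+ 2 - 2 * Re (dot x y) + hnorm y ^+ 2.
Proof. by rewrite sqr_hnormD dotNr hnormN raddfN /= mulrN. Qed.

Lemma bop_exists (f : K -> K) (M : R) : linear f ->
  (forall x, hnorm (f x) <= M * hnorm x) -> exists A : bop K, A =1 f.
Proof.
move=> lf fM.
pose f' : {linear K -> K} := HB.pack f (GRing.isLinear.Build _ _ _ _ _ lf).
suff cf : continuous f' by exists (@Bop _ K f' cf).
apply/bounded_linear_continuous/linear_boundedP.
near=> r => x /=.
rewrite !hnormE (@le_trans _ _ (M%:C * (hnorm x)%:C))//.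
  by rewrite -rmorphM lecR.
rewrite ler_wpM2r ?ler0c ?hnorm_ge0//; near: r; apply: nbhs_pinfty_ge.
by rewrite complex_real.
Unshelve. all: by end_near. Qed.

Definition commutes A B := forall x, A (B x) = B (A x).
Definition selfadjoint A := forall x y, dot (A x) y = dot x (A y).
Definition contractive A := forall x, hnorm (A x) <= hnorm x.

Lemma hnorm_cvg (u : nat -> K) (l : K) : u n @[n --> \oo] --> l <->
  forall e, 0 < e -> \forall n \near \oo, hnorm (l - u n) < e.
Proof.
split=> [/cvgrPdist_lt ul e e0|h].
  have /ul : 0 < e%:C by rewrite ltcR.
  by apply: filterS => n; rewrite hnormE ltcR.
apply/cvgrPdist_lt => e e0.
have eE : e = (Re e)%:C by rewrite RRe_real// gtr0_real.
have e0' : 0 < Re e by rewrite -ltcR -eE.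
by apply: filterS (h _ e0') => n; rewrite hnormE eE ltcR.
Qed.

Lemma cvg_dotl (u : nat -> K) (l y : K) : u n @[n --> \oo] --> l ->
  Re (dot (u n) y) @[n --> \oo] --> Re (dot l y).
Proof.
move=> ul; apply/cvgrPdist_lt => e e0.
pose C := hnorm y + 1.
have C0 : 0 < C by rewrite ltr_wpDl ?hnorm_ge0.
have /hnorm_cvg/(_ (e / C)) := ul.
rewrite divr_gt0// => /(_ isT); apply: filterS => n; rewrite ltr_pdivlMr// => h.
rewrite -raddfB/= -dotBl ltr_norml.
have h1 := Re_dot_le (- (l - u n)) y; have h2 := Re_dot_le (l - u n) y.
rewrite dotNl raddfN hnormN /= in h1; have h3 := hnorm_ge0 (l - u n).
rewrite /C in h.
by apply/andP; split; lra.
Qed.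

Lemma hcauchy_cvg (u : nat -> K) :
  (forall e, 0 < e -> exists N, forall n, (N <= n)%N -> hnorm (u N - u n) < e) ->
  cvg (u n @[n --> \oo]).
Proof.
move=> uC; apply/cauchy_cvgP/cauchyP => e e0.
have eE : e = (Re e)%:C by rewrite RRe_real// gtr0_real.
have e0' : 0 < Re e by rewrite -ltcR -eE.
have [N NP] := uC _ e0'.
exists (u N); exists N => // n /= Nn.
by rewrite -ball_normE/= hnormE eE ltcR NP.
Qed.

(** The operators needed below (square roots, a kernel projection) are only
    limits at every vector, and this is enough: self-adjointness and the
    commutation relations survive such limits. *)
Lemma strong_limit (T : nat -> bop K) : (forall n, contractive (T n)) ->
  (forall x e, 0 < e -> exists N, forall n, (N <= n)%N -> hnorm (T N x - T n x) < e) ->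
  exists L : bop K, contractive L /\ forall x, T n x @[n --> \oo] --> L x.
Proof.
move=> Tc TC.
have cv x : cvg (T n x @[n --> \oo]) by apply: hcauchy_cvg => e; exact: TC.
pose l x := lim (T n x @[n --> \oo]).
have lP x : T n x @[n --> \oo] --> l x by exact: cv.
have llin : linear l.
  move=> a x y; apply: (@norm_cvg_unique _ _ (T n (a *: x + y) @[n --> \oo])); first exact: lP.
  have e n : T n (a *: x + y) = a *: T n x + T n y by rewrite linearD linearZ.
  rewrite (funext e).
  by apply: cvgD; [apply: cvgZr; exact: lP|exact: lP].
have lc x : hnorm (l x) <= 1 * hnorm x.
  rewrite mul1r; apply/ler_addgt0Pr => e e0.
  have /hnorm_cvg/(_ _ e0)[N _ /(_ _ (leqnn N))/= h] := lP x.
  have := ler_hnormD (l x - T N x) (T N x); rewrite subrK.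
  have := Tc N x; lra.
have [L LE] := bop_exists llin lc.
by exists L; split => x; rewrite LE//; have := lc x; rewrite mul1r.
Qed.

Section Limit.
Variables (T : nat -> bop K) (L : bop K).
Hypothesis TL : forall x, T n x @[n --> \oo] --> L x.

Lemma commute_limit B : (forall n, commutes B (T n)) -> commutes B L.
Proof.
move=> BT x; apply: (@norm_cvg_unique _ _ (B (T n x) @[n --> \oo])).
  exact: (continuous_cvg _ (@bop_continuous _ _ B (L x)) (@TL x)).
by rewrite (funext (fun n => BT n x)); exact: (@TL (B x)).
Qed.

Lemma selfadjoint_limit : (forall n, selfadjoint (T n)) -> selfadjoint L.
Proof.
move=> Ts.
have h x y : Re (dot (L x) y) = Re (dot x (L y)).
  have e n : Re (dot (T n x) y) = Re (dot (T n y) x).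
    by rewrite Ts dotC; case: (dot _ _).
  have := cvg_dotl (y := y) (@TL x); rewrite (funext e) => h1.
  have := cvg_dotl (y := x) (@TL y) => h2.
  by rewrite (norm_cvg_unique h1 h2) dotC; case: (dot _ _).
move=> x y; apply/eqP; rewrite eq_complex h eqxx/=.
have := h ('i *: x) y; rewrite linearZ !dotZl /=.
by case: (dot _ _) => a b; case: (dot _ _) => a' b' /=; rewrite !mul0r !mul1r !sub0r => /oppr_inj ->.
Qed.
End Limit.

Lemma bop_comb_exists a b A B : exists C : bop K, forall x, C x = a *: A x + b *: B x.
Proof.
have [M M0 MP] := bop_bounded A; have [N N0 NP] := bop_bounded B.
apply: (@bop_exists _ (Re `|a| * M + Re `|b| * N)).
  move=> c x y; rewrite !linearD !linearZ /= !scalerA (mulrC a) (mulrC b).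
  by rewrite addrACA.
move=> x; rewrite (le_trans (ler_hnormD _ _))// !hnormZ mulrDl -!mulrA.
by rewrite lerD// ler_wpM2l// -ler0c RRe_real ?normr_real.
Qed.

(** * Square roots of contractions and kernel projections *)

(** The scalar instance, at 1, of the iteration of [operator_sqrt]; it dominates
    the general one. *)
Lemma sqrt_iteration_bounds (y : nat -> R) : y 0%N = 0 ->
  (forall n, y n.+1 = (1 + y n ^+ 2) / 2) ->
  (forall n, 0 <= y n <= 1 /\ y n <= y n.+1).
Proof.
move=> y0 yS n; have h : 0 <= y n <= 1.
  by elim: n => [|n /andP[a b]]; rewrite ?y0 ?lexx ?ler01// yS; apply/andP; split; nra.
by split=> //; rewrite yS; have := sqr_ge0 (1 - y n); lra.
Qed.

(** A square root of 1 - X for any self-adjoint contraction X. The iteration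
    T' = (X + T^2)/2 started at 0 has limit 1 - sqrt (1 - X). All iterates
    commute, so T'' - T' = (T' + T)(T' - T)/2, and by induction the norms of
    T and of T' - T are at most those of the same iteration at the scalar 1,
    which is increasing and bounded. *)
Lemma operator_sqrt X : selfadjoint X -> contractive X ->
  exists Y : bop K, [/\ selfadjoint Y, forall x, Y (Y x) = x - X x &
    forall B, commutes B X -> commutes B Y].
Proof.
move=> sX cX.
have step (Y : bop K) : {Z : bop K | forall x, Z x = (2^-1)%:C *: X x + (2^-1)%:C *: Y (Y x)}.
  by apply/cid; have [Z ZP] := bop_comb_exists (2^-1)%:C (2^-1)%:C X (bop_comp Y Y); exists Z.
have [Z0 Z0P] := bop_comb_exists 0 0 X X.
have {}Z0P x : Z0 x = 0 by rewrite Z0P !scale0r addr0.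
have [T [T0 TS]] : exists T : nat -> bop K, (forall x, T 0%N x = 0) /\
    forall n x, T n.+1 x = (2^-1)%:C *: X x + (2^-1)%:C *: T n (T n x).
  exists (fun n => iter n (fun Y => projT1 (step Y)) Z0); split => // n x.
  by rewrite iterS; case: (step _) => Z ZP /=; exact: ZP.
have [y [y0 yS]] : exists y : nat -> R, y 0%N = 0 /\ forall n, y n.+1 = (1 + y n ^+ 2) / 2.
  by exists (fun n => iter n (fun t => (1 + t ^+ 2) / 2) 0).
have yP := sqrt_iteration_bounds y0 yS.
have Tc n x : hnorm (T n x) <= y n * hnorm x.
  elim: n x => [x|n IH x]; first by rewrite T0 ?y0 hnorm0 mul0r.
  rewrite TS (le_trans (ler_hnormD _ _))// !hnormZr ger0_norm ?invr_ge0//.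
  have h1 := cX x; have h2 := IH (T n x); have h3 := IH x.
  have h4 : y n * hnorm (T n x) <= y n * (y n * hnorm x).
    by rewrite ler_wpM2l//; have [/andP[]] := yP n.
  by rewrite yS; lra.
have TX B : commutes B X -> forall n, commutes B (T n).
  move=> BX; elim=> [x|n IH x]; first by rewrite !T0 linear0.
  by rewrite !TS linearD !linearZ /= BX !IH.
have TT n m : commutes (T n) (T m) by apply: (TX) => x; rewrite (TX X (fun=> erefl)).
have dT n x : hnorm (T n.+1 x - T n x) <= (y n.+1 - y n) * hnorm x.
  elim: n x => [x|n IH x].
    rewrite TS !T0 scaler0 addr0 subr0 hnormZr ger0_norm ?invr_ge0//.
    by have := cX x; rewrite yS y0; lra.
  have -> : T n.+2 x - T n.+1 x =
      (2^-1)%:C *: (T n.+1 (T n.+1 x - T n x) + T n (T n.+1 x - T n x)).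
    rewrite (TS n.+1) [Z in _ - Z = _]TS opprD addrACA subrr add0r !linearB /=.
    by rewrite (TT n n.+1 x) addrA subrK scalerBr.
  rewrite hnormZr ger0_norm ?invr_ge0//.
  have := ler_hnormD (T n.+1 (T n.+1 x - T n x)) (T n (T n.+1 x - T n x)).
  have h1 := Tc n.+1 (T n.+1 x - T n x); have h2 := Tc n (T n.+1 x - T n x).
  have h3 := IH x.
  have [/andP[a0 a1] _] := yP n; have [/andP[b0 b1] _] := yP n.+1.
  have h4 : (y n.+1 + y n) * hnorm (T n.+1 x - T n x) <=
            (y n.+1 + y n) * ((y n.+1 - y n) * hnorm x).
    by rewrite ler_wpM2l// addr_ge0.
  have -> : y n.+2 - y n.+1 = 2^-1 * ((y n.+1 + y n) * (y n.+1 - y n)).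
    by rewrite (yS n.+1) [Z in _ - Z = _]yS; field.
  by rewrite -!mulrA !ler_pM2l ?invr_gt0// => /le_trans; apply; lra.
have dTk n k x : hnorm (T (n + k)%N x - T n x) <= (y (n + k)%N - y n) * hnorm x.
  elim: k => [|k IH]; first by rewrite addn0 !subrr hnorm0 mul0r.
  rewrite addnS; have := ler_hnormD (T (n + k).+1 x - T (n + k)%N x) (T (n + k)%N x - T n x).
  by rewrite addrA subrK; have := dT (n + k)%N x; lra.
have ym : {homo y : n m / (n <= m)%N >-> n <= m}.
  by apply/nondecreasing_seqP => n; have [] := yP n.
have ycv : cvgn y.
  apply: nondecreasing_is_cvgn => //.
  by exists 1 => _ [n _ <-]; have [/andP[]] := yP n.
have [Y [cY TY]] : exists Y : bop K, contractive Y /\ forall x, T n x @[n --> \oo] --> Y x.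
  apply: strong_limit => [n x|x e e0].
    by rewrite (le_trans (Tc n x))// ler_piMl ?hnorm_ge0//; have [/andP[]] := yP n.
  pose C := hnorm x + 1; have C0 : 0 < C by rewrite ltr_wpDl ?hnorm_ge0.
  have /cvgrPdist_lt/(_ (e / C)) := ycv; rewrite divr_gt0// => /(_ isT)[N _ NP].
  exists N => n Nn; rewrite -hnormN opprB.
  have := dTk N (n - N)%N x; rewrite subnKC// => /le_lt_trans; apply.
  have yl m : y m <= limn y by exact: nondecreasing_cvgn_le.
  have := NP N (leqnn N); rewrite /= ger0_norm ?subr_ge0// ltr_pdivlMr// => h.
  apply: le_lt_trans h.
  by rewrite ler_pM ?hnorm_ge0 ?subr_ge0 ?ym ?lerD2r ?yl// lerDl.
have TTY x : T n (T n x) @[n --> \oo] --> Y (Y x).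
  apply/hnorm_cvg => e e0; have e2 : 0 < e / 2 by rewrite divr_gt0.
  apply: filterS2 ((hnorm_cvg _ _).1 (TY x) _ e2) ((hnorm_cvg _ _).1 (TY (Y x)) _ e2) => n h1 h2.
  have := ler_hnormD (Y (Y x) - T n (Y x)) (T n (Y x - T n x)).
  rewrite linearB /= addrA subrK => /le_lt_trans; apply.
  have := Tc n (Y x - T n x); have [/andP[a0 a1] _] := yP n.
  have : y n * hnorm (Y x - T n x) <= hnorm (Y x - T n x) by rewrite ler_piMl ?hnorm_ge0.
  rewrite linearB /=; lra.
have YE x : Y x = (2^-1)%:C *: X x + (2^-1)%:C *: Y (Y x).
  apply: (@norm_cvg_unique _ _ (T n.+1 x @[n --> \oo])).
    by have := TY x; rewrite -(cvg_shiftS (fun n => T n x)).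
  rewrite (funext (fun n => TS n x)); apply: cvgD; first exact: cvg_cst.
  by apply: cvgZr; exact: TTY.
have [Z ZP] := bop_comb_exists 1 (-1) (bop_id) Y.
have {}ZP x : Z x = x - Y x by rewrite ZP scale1r scaleN1r.
have Ts n : selfadjoint (T n).
  elim: n => [x z|n IH x z]; first by rewrite !T0 dot0l dot0r.
  by rewrite !TS dotDl dotDr !dotZl !dotZr sX !IH conj_realC.
have Ys := selfadjoint_limit TY Ts.
exists Z; split.
- by move=> x z; rewrite !ZP dotBl dotBr Ys.
- move=> x; rewrite !ZP linearB /=.
  have := YE x; move/(congr1 (fun z => z + z)).
  rewrite addrACA -!scalerDl -rmorphD -[2^-1]mul1r -splitr rmorph1 !scale1r => e.
  have -> : X x = Y x + Y x - Y (Y x) by rewrite e addrK.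
  by rewrite -addrA -opprD addrA.
- move=> B BX x; rewrite !ZP linearB /=.
  by rewrite (commute_limit TY (TX _ BX)).
Qed.

(** The projection onto ker S is the strong limit of D^(2n), D = 1 - S^2:
    D fixes ker S, is a contraction, and
    |D^(2n) x - D^(2m) x|^2 = |D^(2n) x|^2 - 2 |D^(n+m) x|^2 + |D^(2m) x|^2
    tends to 0 because |D^n x| decreases. On the range of the limit D^2 is the
    identity, and |D y|^2 <= |y|^2 - |S y|^2 then forces S y = 0. *)
Lemma kernel_projection_contractive S : selfadjoint S -> contractive S ->
  exists P : bop K, [/\ selfadjoint P, forall x, S (P x) = 0,
    forall x, S x = 0 -> P x = x & forall B, commutes B S -> commutes B P].
Proof.
move=> sS cS.
have [D DP] := bop_comb_exists 1 (-1) bop_id (bop_comp S S).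
have {}DP x : D x = x - S (S x) by rewrite DP scale1r scaleN1r.
have sD : selfadjoint D by move=> x y; rewrite !DP dotBl dotBr !sS.
have Dx x : hnorm (D x) ^+ 2 <= hnorm x ^+ 2 - hnorm (S x) ^+ 2.
  rewrite DP sqr_hnormB -sS -sqr_hnorm.
  have : hnorm (S (S x)) ^+ 2 <= hnorm (S x) ^+ 2 by rewrite ler_pXn2r ?nnegrE ?hnorm_ge0.
  lra.
have cD : contractive D.
  move=> x; rewrite -(@ler_pXn2r _ 2) ?nnegrE ?hnorm_ge0// (le_trans (Dx x))//.
  by rewrite gerBl sqr_ge0.
pose T n := iter n (fun A => bop_comp D (bop_comp D A)) (bop_id : bop K).
have TE n x : T n x = iter n.*2 D x by elim: n => //= n ->.
have sDn n x y : dot (iter n D x) y = dot x (iter n D y).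
  by elim: n x y => //= n IH x y; rewrite sD IH -iterSr.
have cDn n x : hnorm (iter n D x) <= hnorm x.
  by elim: n => //= n IH; exact: le_trans (cD _) IH.
have dD x : {homo (fun n => - hnorm (iter n D x) ^+ 2) : n m / (n <= m)%N >-> n <= m}.
  apply/nondecreasing_seqP => n; rewrite lerN2 ler_pXn2r ?nnegrE ?hnorm_ge0//=.
have [P [cP TP]] : exists P : bop K, contractive P /\ forall x, T n x @[n --> \oo] --> P x.
  apply: strong_limit => [n x|x e e0]; first by rewrite TE.
  have cv : cvgn (fun n => - hnorm (iter n D x) ^+ 2).
    by apply: nondecreasing_is_cvgn => //; exists 0 => _ [n _ <-]; rewrite oppr_le0 sqr_ge0.
  have h m : - hnorm (iter m D x) ^+ 2 <= limn (fun n => - hnorm (iter n D x) ^+ 2).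
    exact: (nondecreasing_cvgn_le (dD x)).
  have /cvgrPdist_lt/(_ (e ^+ 2)) := cv; rewrite exprn_gt0// => /(_ isT)[N _ NP].
  exists N => n Nn; rewrite -(@ltr_pXn2r _ 2) ?nnegrE ?hnorm_ge0 1?ltW//.
  have := NP N (leqnn N); rewrite /= ger0_norm ?subr_ge0//.
  apply: le_lt_trans; rewrite sqr_hnormB !TE.
  have -> : dot (iter N.*2 D x) (iter n.*2 D x) = dot (iter (N + n) D x) (iter (N + n) D x).
    by rewrite -!sDn -!iterD -!addnn; congr (dot (iter _ D x) x); lia.
  rewrite -sqr_hnorm.
  have h1 := h (n.*2); have h2 := h (N + n)%N; have h3 := h N.
  have h4 := dD x N (N.*2); have h5 := dD x (N + n)%N n.*2.
  have := h4 _; rewrite -addnn leq_addr => /(_ isT) {}h4.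
  have := h5 _; rewrite -addnn leq_add2r Nn => /(_ isT) {}h5.
  rewrite /= -!addnn in h1 h2 h3 *; lra.
have sP : selfadjoint P.
  by apply: (selfadjoint_limit TP) => n x y; rewrite !TE.
have BP B : commutes B S -> commutes B P.
  move=> BS; apply: (commute_limit TP) => n x; rewrite !TE.
  by elim: n.*2 => //= m <-; rewrite !DP linearB /= !BS.
exists P; split => //.
- move=> x; have DDP : D (D (P x)) = P x.
    have := commute_limit TP (B := bop_comp D D) => /(_ _ x)/= ->; last first.
      by move=> n z /=; rewrite !TE -!iterS -!iterSr.
    apply: (@norm_cvg_unique _ _ (T n (D (D x)) @[n --> \oo])); first exact: TP.
    have e n : T n (D (D x)) = T n.+1 x by rewrite !TE doubleS !iterSr.
    rewrite (funext e); have := TP x; rewrite -(cvg_shiftS (fun n => T n x)); exact.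
  apply: hnorm_eq0; apply/eqP; rewrite -sqrf_eq0 eq_le sqr_ge0 andbT.
  have h1 := Dx (P x).
  have : hnorm (P x) <= hnorm (D (P x)) by rewrite -{1}DDP cD.
  rewrite -(@ler_pXn2r _ 2) ?nnegrE ?hnorm_ge0//; lra.
- move=> x Sx; apply: (@norm_cvg_unique _ _ (T n x @[n --> \oo])); first exact: TP.
  have -> : (fun n => T n x) = fun=> x.
    apply/funext => n; rewrite TE; elim: n.*2 => //= m ->.
    by rewrite DP Sx linear0 subr0.
  exact: cvg_cst.
Qed.

End Hilbert.

(** * Square roots of unitary operators *)

Section UnitarySqrt.
Context {R : realType} {K : hilbertType R}.
Implicit Types (x y z u v : K) (a : R[i]) (t : R) (A B : bop K).

Lemma adjPl A x y : dot (adj A x) y = dot x (A y).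
Proof. by rewrite dotC -adjP -dotC. Qed.

Lemma adjE A B : (forall x y, dot (A x) y = dot x (B y)) -> adj A = B.
Proof. by move=> h; apply: bop_ext => y; apply: dot_inj => x; rewrite -adjP h. Qed.

Lemma adjK A : adj (adj A) = A.
Proof. by apply: adjE => x y; rewrite adjPl. Qed.

Lemma unitaryK A : unitary A -> cancel A (adj A).
Proof. by case=> /(congr1 (fun B : bop K => B : K -> K)) h _ x; have /(congr1 (@^~ x)) := h. Qed.

Lemma unitaryVK A : unitary A -> cancel (adj A) A.
Proof. by case=> _ /(congr1 (fun B : bop K => B : K -> K)) h x; have /(congr1 (@^~ x)) := h. Qed.

Lemma unitaryP A : cancel A (adj A) -> cancel (adj A) A -> unitary A.
Proof. by move=> h1 h2; split; apply: bop_ext => x /=; rewrite ?h1 ?h2. Qed.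

Lemma unitary_adj A : unitary A -> unitary (adj A).
Proof. by move=> uA; apply: unitaryP; rewrite adjK; [exact: unitaryVK|exact: unitaryK]. Qed.

Lemma unitary_dot A x y : unitary A -> dot (A x) (A y) = dot x y.
Proof. by move=> uA; rewrite adjP unitaryK. Qed.

Lemma unitary_hnorm A x : unitary A -> hnorm (A x) = hnorm x.
Proof.
move=> uA; apply/eqP; rewrite -(@eqrXn2 _ 2) ?hnorm_ge0//.
by rewrite !sqr_hnorm unitary_dot.
Qed.

Lemma kernel_projection S : selfadjoint S ->
  exists P : bop K, [/\ selfadjoint P, forall x, S (P x) = 0,
    forall x, S x = 0 -> P x = x & forall B, commutes B S -> commutes B P].
Proof.
move=> sS; have [M M0 SM] := bop_bounded S.
pose k : R := (M + 1)^-1.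
have k0 : 0 < k by rewrite invr_gt0 ltr_wpDl.
have [S' S'P] := bop_comb_exists k%:C 0 S S.
have {}S'P x : S' x = k%:C *: S x by rewrite S'P scale0r addr0.
have kz : k%:C != 0 by rewrite fmorph_eq0 gt_eqF.
have [|x|P [sP SP PS cP]] := @kernel_projection_contractive _ _ S'.
- by move=> x y; rewrite !S'P dotZl dotZr conj_realC sS.
- rewrite S'P hnormZr gtr0_norm// mulrC ler_pdivrMr ?ltr_wpDl//.
  by have := SM x; have := hnorm_ge0 x; lra.
exists P; split => //.
- by move=> x; have /eqP := SP x; rewrite S'P scaler_eq0 (negbTE kz) => /eqP.
- by move=> x Sx; apply: PS; rewrite S'P Sx scaler0.
- by move=> B BS; apply: cP => x; rewrite !S'P linearZ /= BS.
Qed.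

(** With U = C + iS, the operators c = sqrt ((1 + C)/2) and
    d = sqrt ((1 - C)/2) satisfy c^2 + d^2 = 1, c^2 - d^2 = C and
    (2cd)^2 = S^2, as the cosine and the sine of half an angle do, but 2cd may
    differ from S by a sign. If P projects onto the kernel of 2cd + S, then
    2cd - S takes its values there, so J = 1 - 2P satisfies J (2cd) = S, and
    A = c + i J d is a unitary root of U. Each ingredient commutes with
    whatever commutes with U. *)
Lemma unitary_sqrt U : unitary U -> exists A : bop K, [/\ unitary A,
  forall x, A (A x) = U x & forall B, commutes B U -> commutes B A].
Proof.
move=> uU.
have BU' B : commutes B U -> commutes B (adj U).
  by move=> BU x; rewrite -[in RHS](unitaryVK uU x) BU unitaryK.
pose h : R[i] := 2^-1.
have ch : h^* = h := conjV2.
have [C CP] := bop_comb_exists h h U (adj U).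
have [S SP] := bop_comb_exists (- 'i * h) ('i * h) U (adj U).
have BC B : commutes B U -> commutes B C.
  by move=> BU x; rewrite !CP linearD !linearZ /= BU BU'.
have BS B : commutes B U -> commutes B S.
  by move=> BU x; rewrite !SP linearD !linearZ /= BU BU'.
have sC : selfadjoint C.
  by move=> x y; rewrite !CP !(dotDl,dotDr,dotZl,dotZr) ch adjPl adjP addrC.
have sS : selfadjoint S.
  move=> x y; rewrite !SP !(dotDl,dotDr,dotZl,dotZr) !rmorphM rmorphN /= conji ch adjPl adjP addrC.
  by rewrite opprK.
have cC : contractive C.
  move=> x; rewrite CP (le_trans (ler_hnormD _ _))// /h -realCV2 !hnormZr.
  by rewrite !unitary_hnorm//; [rewrite ger0_norm ?invr_ge0//; lra|exact: unitary_adj].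
have CS x : C (C x) + S (S x) = x.
  rewrite !CP !SP !linearD !linearZ /= !unitaryK// !unitaryVK//.
  apply: dot_injl => w; rewrite !(dotDl,dotZl).
  move: (dot x w) (dot (U (U x)) w) (dot (adj U (adj U x)) w) => a b c.
  by rewrite /h; field: (@mulii R).
have CiS x : C x + 'i *: S x = U x.
  rewrite CP SP; apply: dot_injl => w; rewrite !(dotDl,dotZl).
  move: (dot (U x) w) (dot (adj U x) w) => a b.
  by rewrite /h; field: (@mulii R).
(* The arguments of operator_sqrt: 1 - X1 = (1 + C)/2, 1 - X2 = (1 - C)/2. *)
have half (e : R[i]) : e^* = e -> Re `|e| <= 2^-1 -> exists X : bop K,
    [/\ forall x, X x = h *: x + e *: C x, selfadjoint X & contractive X].
  move=> ce ne; have [X XP] := bop_comb_exists h e bop_id C.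
  exists X; split => // x.
    by move=> y; rewrite !XP !(dotDl,dotDr,dotZl,dotZr) ch ce sC.
  rewrite XP (le_trans (ler_hnormD _ _))// /h -realCV2 hnormZr ger0_norm ?invr_ge0// hnormZ.
  have h1 : Re `|e| * hnorm (C x) <= 2^-1 * hnorm x.
    by rewrite ler_pM ?hnorm_ge0// -ler0c RRe_real ?normr_real.
  by rewrite (le_trans (lerD (lexx _) h1))//=; lra.
have nh : Re `|h| <= 2^-1 by rewrite /h -realCV2 normc_def/= expr0n/= addr0 sqrtr_sqr ger0_norm ?invr_ge0.
have [X1 [X1P sX1 cX1]] := half (- h) (ltac:(by rewrite rmorphN/= ch)) (ltac:(by rewrite normrN)).
have [X2 [X2P sX2 cX2]] := half h ch nh.
have [c [sc cc Bc]] := operator_sqrt sX1 cX1.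
have [d [sd dd Bd]] := operator_sqrt sX2 cX2.
have {cc}cc x : c (c x) = h *: x + h *: C x.
  rewrite cc X1P; apply: dot_injl => w; rewrite !(dotDl,dotZl,dotNl).
  by move: (dot x w) (dot (C x) w) => a b; rewrite /h; field.
have {dd}dd x : d (d x) = h *: x - h *: C x.
  rewrite dd X2P; apply: dot_injl => w; rewrite !(dotDl,dotZl,dotNl).
  by move: (dot x w) (dot (C x) w) => a b; rewrite /h; field.
have {}Bc B : commutes B U -> commutes B c.
  by move=> BU; apply: Bc => x; rewrite !X1P linearD !linearZ /= BC.
have {}Bd B : commutes B U -> commutes B d.
  by move=> BU; apply: Bd => x; rewrite !X2P linearD !linearZ /= BC.
have com_sym A B : commutes A B -> commutes B A by move=> AB x; rewrite AB.
have cU : commutes c U by apply/com_sym/Bc.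
have dU : commutes d U by apply/com_sym/Bd.
have cd := Bd _ cU : commutes c d.
have cS := BS _ cU : commutes c S.
have dS := BS _ dU : commutes d S.
have [Sp SpP] := bop_comb_exists 2 1 (bop_comp c d) S.
have {}SpP x : Sp x = 2 *: c (d x) + S x by rewrite SpP scale1r.
have sSp : selfadjoint Sp.
  move=> x y; rewrite !SpP !(dotDl,dotDr,dotZl,dotZr) sc sd sS cd.
  by rewrite rmorph_nat.
have BSp B : commutes B U -> commutes B Sp.
  by move=> BU x; rewrite !SpP linearD linearZ /= Bc// Bd// BS.
(* Sp and Sm = 2cd - S satisfy Sp Sm = (2cd)^2 - S^2 = 0. *)
have [P [sP SpP0 PSp BP]] := kernel_projection sSp.
have {}BP B : commutes B U -> commutes B P by move=> BU; exact/BP/BSp.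
have PP x : P (P x) = P x by apply: PSp; rewrite SpP0.
have SpU : commutes Sp U by apply/com_sym/BSp.
have PU : commutes P U by apply/com_sym/BP.
have PSp0 x : P (Sp x) = 0 by rewrite -(BP _ SpU) SpP0.
have cdcd x : c (d (c (d x))) = (h * h) *: (x - C (C x)).
  rewrite -(cd (d x)) cc dd !linearB !linearZ /=; apply: dot_injl => w.
  rewrite !(dotDl,dotZl,dotNl).
  by move: (dot x w) (dot (C x) w) (dot (C (C x)) w) => a b e; rewrite /h; field.
have SpSm x : Sp (2 *: c (d x) - S x) = 0.
  rewrite SpP !linearB !linearZ /= cdcd dS cS -{1}(CS x) [C (C x) + _]addrC addrK.
  rewrite scalerN; apply: dot_injl => w; rewrite !(dotDl,dotZl,dotNl) dot0l.
  by move: (dot (S (S x)) w) (dot (S (c (d x))) w) => a b; rewrite /h; field.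
have PT x : P (2 *: c (d x)) = h *: (2 *: c (d x) - S x).
  have e : 2 *: c (d x) = h *: Sp x + h *: (2 *: c (d x) - S x).
    rewrite SpP; apply: dot_injl => w; rewrite !(dotDl,dotZl,dotNl).
    by move: (dot (c (d x)) w) (dot (S x) w) => a b; rewrite /h; field.
  by rewrite {1}e linearD !linearZ /= PSp0 scaler0 add0r PSp ?SpSm.
have [J JP] := bop_comb_exists 1 (- 2) bop_id P.
have {}JP x : J x = x - 2 *: P x by rewrite JP scale1r scaleNr.
have sJ : selfadjoint J.
  by move=> x y; rewrite !JP dotBl dotBr dotZl dotZr sP rmorph_nat.
have JJ x : J (J x) = x.
  rewrite !JP !linearB !linearZ /= PP; apply: dot_injl => w; rewrite !(dotDl,dotZl,dotNl).
  by move: (dot x w) (dot (P x) w) => a b; ring.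
have BJ B : commutes B U -> commutes B J.
  by move=> BU x; rewrite !JP linearB linearZ /= BP.
have cJ := BJ _ cU : commutes c J.
have dJ := BJ _ dU : commutes d J.
have JT x : 2 *: J (c (d x)) = S x.
  have -> : 2 *: J (c (d x)) = J (2 *: c (d x)) by rewrite linearZ.
  rewrite JP PT; apply: dot_injl => w; rewrite !(dotDl,dotZl,dotNl).
  by move: (dot (c (d x)) w) (dot (S x) w) => a b; rewrite /h; field.
have [A AP] := bop_comb_exists 1 'i c (bop_comp J d).
have {}AP x : A x = c x + 'i *: J (d x) by rewrite AP scale1r.
have [A' A'P] := bop_comb_exists 1 (- 'i) c (bop_comp J d).
have {}A'P x : A' x = c x - 'i *: J (d x) by rewrite A'P scale1r scaleNr.
have adA : adj A = A'.
  apply: adjE => x y; rewrite AP A'P !(dotDl,dotZl,dotDr,dotZr,dotNr) sc sJ sd dJ.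
  by rewrite conji mulNr opprK.
have ccdd x : c (c x) + d (d x) = x.
  rewrite cc dd; apply: dot_injl => w; rewrite !(dotDl,dotZl,dotNl).
  by move: (dot x w) (dot (C x) w) => a b; rewrite /h; field.
exists A; split.
- apply: unitaryP => x; rewrite adA.
    rewrite A'P !AP !(linearD, linearN, linearZ) /= !dJ JJ !cJ -!cd.
    apply: dot_injl => w; rewrite -[in RHS](ccdd x) !(dotDl,dotZl,dotNl).
    move: (dot (c (c x)) w) (dot (d (d x)) w) (dot (J (c (d x))) w) => a b e.
    by ring: (@mulii R).
  rewrite AP !A'P !(linearD, linearN, linearZ) /= !dJ JJ !cJ -!cd.
  apply: dot_injl => w; rewrite -[in RHS](ccdd x) !(dotDl,dotZl,dotNl).
  move: (dot (c (c x)) w) (dot (d (d x)) w) (dot (J (c (d x))) w) => a b e.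
  by ring: (@mulii R).
- move=> x; rewrite -CiS -JT !AP !(linearD, linearZ) /= !dJ JJ !cJ -!cd cc dd.
  apply: dot_injl => w; rewrite !(dotDl,dotZl,dotNl).
  move: (dot x w) (dot (C x) w) (dot (J (c (d x))) w) => a b e.
  by rewrite /h; field: (@mulii R).
- by move=> B BU x; rewrite !AP linearD linearZ /= Bc// BJ// Bd.
Qed.

(** From left to right U is A^2. From right to left, the adjoint of
    adj Q_n = Q_n U is Q_n = (adj U)(adj Q_n), and substituting one into the
    other shows that U, hence its root A, commutes with Q_n; then
    adj (A Q_n) = Q_n U (adj A) = Q_n A. *)
Lemma selfadjoint_twist (Qn : nat -> bop K) :
  (exists2 A : bop K, unitary A &
    forall n, bop_comp A (Qn n) = bop_comp (Qn n) A /\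
              bop_comp (Qn n) A = adj (bop_comp A (Qn n))) <->
  (exists2 U : bop K, unitary U & forall n x, adj (Qn n) x = Qn n (U x)).
Proof.
split=> [[A uA AQ]|[U uU QU]].
  exists (bop_comp A A).
    have iA := unitaryK uA; have iA' := unitaryVK uA.
    have adAA : adj (bop_comp A A) = bop_comp (adj A) (adj A).
      by apply: adjE => x y /=; rewrite !adjP.
    by apply: unitaryP => x; rewrite adAA /= ?iA ?iA'.
  move=> n x /=; have [_ /(congr1 (fun B : bop K => (B : K -> K)))/= h] := AQ n.
  apply: dot_inj => y; rewrite -adjP.
  have {}h z : Qn n (A z) = adj (bop_comp A (Qn n)) z by have /(congr1 (@^~ z)) := h.
  by rewrite h -adjP /= unitary_dot.
have QU' n : commutes (Qn n) U.
  move=> x; rewrite -QU; apply: dot_inj => y; rewrite -adjP.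
  rewrite -[in RHS](unitaryVK uU y) unitary_dot// -[Qn n in RHS]adjK -adjP.
  by rewrite QU unitaryVK.
have [A [uA AA BA]] := unitary_sqrt uU.
exists A => // n; split; first by apply: bop_ext => x /=; rewrite (BA _ (QU' n)).
apply/esym/adjE => x y /=.
by rewrite adjP -[in LHS](unitaryVK uA y) unitaryK// adjP QU -AA unitaryVK.
Qed.

End UnitarySqrt.

(** * Integrals of complex functions on the circle *)

Section CircleIntegral.
Context {R : realType}.
Local Notation mu := (@circle_measure R).
Implicit Types (f g h : circle R -> R[i]) (a : R[i]) (b : circle R -> R).

Definition cmeasurable g :=
  measurable_fun setT (fun z => Re (g z)) /\ measurable_fun setT (fun z => Im (g z)).

Definition cintegrable g :=
  mu.-integrable setT (fun z => (Re (g z))%:E) /\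
  mu.-integrable setT (fun z => (Im (g z))%:E).

Lemma cintegrable_cmeasurable g : cintegrable g -> cmeasurable g.
Proof. by move=> [/measurable_int/measurable_EFinP + /measurable_int/measurable_EFinP]. Qed.

Lemma cmeasurable_cst a : cmeasurable (fun=> a).
Proof. by []. Qed.

Lemma cmeasurableD f g : cmeasurable f -> cmeasurable g ->
  cmeasurable (fun z => f z + g z).
Proof.
move=> [f1 f2] [g1 g2]; split.
  by under eq_fun do rewrite ReD; exact: measurable_funD.
by under eq_fun do rewrite ImD; exact: measurable_funD.
Qed.

Lemma cmeasurableM f g : cmeasurable f -> cmeasurable g ->
  cmeasurable (fun z => f z * g z).
Proof.
move=> [f1 f2] [g1 g2]; split.
  by under eq_fun do rewrite ReM; apply: measurable_funB; exact: measurable_funM.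
by under eq_fun do rewrite ImM; apply: measurable_funD; exact: measurable_funM.
Qed.

Lemma cmeasurableJ g : cmeasurable g -> cmeasurable (fun z => (g z)^*).
Proof.
move=> [g1 g2]; split; first by under eq_fun do rewrite ReJ.
by under eq_fun do rewrite ImJ; apply: measurableT_comp.
Qed.

Lemma cintegrable_dom g b : cmeasurable g ->
  mu.-integrable setT (fun z => (b z)%:E) ->
  (forall z, `|Re (g z)| <= b z /\ `|Im (g z)| <= b z) -> cintegrable g.
Proof.
move=> [g1 g2] ib gb; split; apply: (le_integrable _ _ _ ib) => //=;
  try exact/measurable_EFinP.
- move=> z _; rewrite lee_fin; have [+ _] := gb z => /le_trans; apply; exact: ler_norm.
- move=> z _; rewrite lee_fin; have [_] := gb z => /le_trans; apply; exact: ler_norm.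
Qed.

Lemma cintegrableD f g : cintegrable f -> cintegrable g ->
  cintegrable (fun z => f z + g z).
Proof.
move=> [f1 f2] [g1 g2]; split.
  by under eq_fun do rewrite ReD EFinD; exact: integrableD.
by under eq_fun do rewrite ImD EFinD; exact: integrableD.
Qed.

Lemma cintegrable_bound g : cintegrable g ->
  mu.-integrable setT (fun z => (`|Re (g z)| + `|Im (g z)|)%:E).
Proof.
move=> [g1 g2]; under eq_fun do rewrite EFinD.
by apply: integrableD => //; [apply: integrable_abse g1|apply: integrable_abse g2].
Qed.

Lemma cintegrableMl h g (M : R) : cmeasurable h ->
  (forall z, `|Re (h z)| <= M /\ `|Im (h z)| <= M) ->
  cintegrable g -> cintegrable (fun z => h z * g z).
Proof.
move=> mh hM ig; have mg := cintegrable_cmeasurable ig.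
apply: (@cintegrable_dom _ (fun z => M * (`|Re (g z)| + `|Im (g z)|))).
- exact: cmeasurableM.
- under eq_fun do rewrite EFinM.
  by apply: integrableZl => //; exact: cintegrable_bound.
- move=> z; have [h1 h2] := hM z; rewrite ReM ImM; split.
    rewrite (le_trans (ler_normB _ _))// !normrM mulrDr lerD// ler_wpM2r//.
  by rewrite (le_trans (ler_normD _ _))// !normrM mulrDr addrC lerD// ler_wpM2r.
Qed.

Lemma cintegrableZ a g : cintegrable g -> cintegrable (fun z => a * g z).
Proof.
apply: (@cintegrableMl (fun=> a) g (`|Re a| + `|Im a|)) => // z.
by split; rewrite ?lerDl ?lerDr.
Qed.

Lemma cintegrable_bounded h (M : R) : cmeasurable h ->
  (forall z, `|Re (h z)| <= M /\ `|Im (h z)| <= M) -> cintegrable h.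
Proof.
move=> mh hM; apply: (cintegrable_dom mh _ hM).
exact: finite_measure_integrable_cst.
Qed.

Lemma cintegrable_cst a : cintegrable (fun=> a).
Proof.
apply: (@cintegrable_bounded _ (`|Re a| + `|Im a|)) => // z.
by split; rewrite ?lerDl ?lerDr.
Qed.

Lemma cintegrableJ g : cintegrable g -> cintegrable (fun z => (g z)^*).
Proof.
move=> ig; have [g1 g2] := cintegrableZ (-1) ig; have [f1 f2] := ig.
split; first by under eq_fun do rewrite ReJ.
by move: g2; under [X in integrable _ _ X -> _]eq_fun do rewrite mulN1r ImN -ImJ.
Qed.

Lemma cintegralD f g : cintegrable f -> cintegrable g ->
  cintegral (fun z => f z + g z) = cintegral f + cintegral g.
Proof.
move=> [f1 f2] [g1 g2]; apply: complex_ext; rewrite ?ReD ?ImD /=.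
  by under eq_Rintegral do rewrite ReD; rewrite RintegralD.
by under eq_Rintegral do rewrite ImD; rewrite RintegralD.
Qed.

Lemma cintegralZ a g : cintegrable g ->
  cintegral (fun z => a * g z) = a * cintegral g.
Proof.
move=> [g1 g2].
have Z (r : R) (u : circle R -> R) : mu.-integrable setT (EFin \o u) ->
    mu.-integrable setT (EFin \o (fun z => r * u z)).
  move=> iu; rewrite (_ : EFin \o _ = fun z => (r%:E * (EFin \o u) z)%E)//.
  exact: integrableZl.
apply: complex_ext; rewrite ?ReM ?ImM /=.
  under eq_Rintegral do rewrite ReM.
  by rewrite RintegralB ?RintegralZl//; apply: Z.
under eq_Rintegral do rewrite ImM.
by rewrite RintegralD ?RintegralZl//; apply: Z.
Qed.

Lemma eq_cintegral f g : f =1 g -> cintegral f = cintegral g.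
Proof. by move=> /funext ->. Qed.

Lemma cintegral_cst a : cintegral (fun=> a) = a.
Proof.
by apply: complex_ext; rewrite /= Rintegral_cst//= probability_setT mulr1.
Qed.

Lemma cintegralJ g : cintegrable g -> cintegral (fun z => (g z)^*) = (cintegral g)^*.
Proof.
move=> [g1 g2]; apply: complex_ext; rewrite ?ReJ ?ImJ /=.
  by under eq_Rintegral do rewrite ReJ.
under eq_Rintegral do rewrite ImJ -mulN1r.
by rewrite RintegralZl// mulN1r.
Qed.

Lemma ae_eq_cintegral f g : cmeasurable f -> cmeasurable g ->
  (\forall z \ae mu, f z = g z) -> cintegral f = cintegral g.
Proof.
move=> [f1 f2] [g1 g2] fg; apply: complex_ext; rewrite /= /Rintegral; congr fine.
  apply: ae_eq_integral => //; try exact/measurable_EFinP.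
  by apply: filterS fg => z ->.
apply: ae_eq_integral => //; try exact/measurable_EFinP.
by apply: filterS fg => z ->.
Qed.

End CircleIntegral.

(** * Invariance of the circle measure under complex conjugation *)

Section CircleMeasure.
Context {R : realType}.
Local Notation mu := (@circle_measure R).
Implicit Types (f g h : circle R -> R[i]) (a : R[i]) (b : circle R -> R).

Lemma measurable_circle_coord : measurable_fun setT (@circle_coord R).
Proof. by move=> _ B mB; exists B. Qed.

Lemma cmeasurable_val : cmeasurable (fun z : circle R => val z).
Proof.
by split; [apply: (measurableT_comp measurable_fst measurable_circle_coord)|
  apply: (measurableT_comp measurable_snd measurable_circle_coord)].
Qed.

Lemma measurable_to_circle d (T : measurableType d) (u : T -> circle R) :
  measurable_fun setT (fun t => Re (val (u t))) ->
  measurable_fun setT (fun t => Im (val (u t))) -> measurable_fun setT u.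
Proof.
move=> u1 u2 _ _ [B mB <-]; rewrite !setTI -comp_preimage.
rewrite -[X in measurable X]setTI.
suff : measurable_fun setT (@circle_coord R \o u) by apply.
exact: measurable_fun_pair.
Qed.

Lemma measurable_circle_conj : measurable_fun setT (@circle_conj R).
Proof.
have [h1 h2] := cmeasurableJ cmeasurable_val.
exact: measurable_to_circle.
Qed.

Lemma circle_conjK : involutive (@circle_conj R).
Proof. by move=> z; apply: val_inj; exact: conjCK. Qed.

Lemma circle_exp_conj (t : R) : circle_conj (circle_exp t) = circle_exp (1 - t).
Proof.
apply: val_inj; rewrite /=; apply: complex_ext => /=.
  by rewrite mulrBr mulr1 mulr_natl cosB cos2pi sin2pi mul1r mul0r addr0.
by rewrite mulrBr mulr1 mulr_natl sinB cos2pi sin2pi mul1r mul0r sub0r.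
Qed.

Lemma lebesgue_measure_onem (A : set R) : measurable A ->
  pushforward lebesgue_measure ((fun t => 1 - t) : _ -> measurableTypeR R) A = lebesgue_measure A.
Proof.
move=> mA.
have mf : @measurable_fun _ _ (measurableTypeR R) (measurableTypeR R) setT (fun t => 1 - t).
  exact: measurable_funB.
pose F : {mfun (measurableTypeR R) >-> (measurableTypeR R)} :=
  HB.pack ((fun t => 1 - t) : measurableTypeR R -> measurableTypeR R) (isMeasurableFun.Build _ _ _ _ _ mf).
apply/esym. apply: (@lebesgue_measure_unique _ (pushforward lebesgue_measure F)) => //= _ [[a b]] _ <-.
rewrite /pushforward.
have -> : (fun t => 1 - t) @^-1` [set` Interval (BRight a) (BRight b)] = `[1 - b, 1 - a[%classic.
  by apply/seteqP; split=> t /=; rewrite !in_itv /= => /andP[h1 h2]; apply/andP; split; lra.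
rewrite !lebesgue_measure_itv/= !lte_fin.
have -> : (1 - b < 1 - a) = (a < b) by rewrite ltrD2l ltrN2.
by case: ifP => // _; rewrite -!EFinD; congr EFin; ring.
Qed.

Lemma circle_measureE A : measurable A ->
  mu A = lebesgue_measure ((@circle_exp R @^-1` A) `&` `[0, 1]%classic).
Proof.
move=> mA; rewrite /circle_measure/= /distribution/= /pushforward /uniform_prob.
have mE : measurable (@circle_exp R @^-1` A).
  by rewrite -[X in measurable X]setTI; exact: measurable_circle_exp.
rewrite integral_uniform_pdf.
rewrite (eq_integral (fun=> 1%E)); last first.
  move=> x; rewrite inE => -[_]; rewrite /= in_itv/= /uniform_pdf => ->.
  by rewrite subr0 invr1.
by rewrite integral_cst ?mul1e//; exact: measurableI.
Qed.

(** In the parameter t of the circle, conjugation is t |-> 1 - t. *)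
Lemma circle_measure_conj A : measurable A ->
  mu ((@circle_conj R) @^-1` A) = mu A.
Proof.
move=> mA; rewrite !circle_measureE//; last first.
  by rewrite -[X in measurable X]setTI; exact: measurable_circle_conj.
have mE : measurable (@circle_exp R @^-1` A).
  by rewrite -[X in measurable X]setTI; exact: measurable_circle_exp.
rewrite -[RHS]lebesgue_measure_onem; last by exact: measurableI.
congr (lebesgue_measure _); apply/seteqP; split=> t /=; rewrite !in_itv/=.
  by rewrite circle_exp_conj => -[? /andP[h1 h2]]; split => //; apply/andP; split; lra.
by rewrite circle_exp_conj => -[? /andP[h1 h2]]; split => //; apply/andP; split; lra.
Qed.

Lemma ae_circle_conj (P : circle R -> Prop) :
  (\forall z \ae mu, P z) -> \forall z \ae mu, P (circle_conj z).
Proof.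
move=> [N [mN N0 PN]]; exists (@circle_conj R @^-1` N); split.
- by rewrite -[X in measurable X]setTI; exact: measurable_circle_conj.
- by rewrite -N0; apply: circle_measure_conj.
- by move=> z /= Pz; apply: PN.
Qed.

Lemma integrable_circle_conj (u : circle R -> R) :
  mu.-integrable setT (EFin \o u) -> mu.-integrable setT (EFin \o (u \o @circle_conj R)) /\
  \int[mu]_z u (circle_conj z) = \int[mu]_z u z.
Proof.
move=> iu; have mconj := measurable_circle_conj.
have mu_u : measurable_fun setT (EFin \o u) := measurable_int _ iu.
have ic : mu.-integrable setT (EFin \o (u \o @circle_conj R)).
  move/integrableP : (iu) => [_ fu]; apply/integrableP; split.
    exact: (measurableT_comp mu_u mconj).
  have := ge0_integral_pushforward mconj mu (D := setT) (f := fun z => `|(u z)%:E|%E) measurableT.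
  rewrite preimage_setT => <- //; last exact: measurableT_comp.
  by rewrite (eq_measure_integral mu)// => A mA _; exact: circle_measure_conj.
split => //; rewrite /Rintegral; congr fine.
have := integral_pushforward mconj (mu := mu) (D := setT) mu_u.
rewrite preimage_setT => <- //.
by apply: eq_measure_integral => A mA _; exact: circle_measure_conj.
Qed.

Lemma cintegrable_conj g : cintegrable g -> cintegrable (g \o @circle_conj R).
Proof. by move=> [/integrable_circle_conj[? _] /integrable_circle_conj[? _]]. Qed.

Lemma cintegral_conj g : cintegrable g ->
  cintegral (fun z => g (circle_conj z)) = cintegral g.
Proof.
move=> [/integrable_circle_conj[_ h1] /integrable_circle_conj[_ h2]].
by apply: complex_ext => /=; [exact: h1|exact: h2].
Qed.

End CircleMeasure.

(** * Orthogonality of the characters *)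

Section Characters.
Context {R : realType}.
Local Notation mu := (@circle_measure R).
Implicit Types (z : circle R) (n m : int).

Lemma circle_neq0 z : val z != 0.
Proof. by rewrite -normr_gt0 (eqP (valP z)). Qed.

Lemma circle_invE z : (val z)^-1 = (val z)^*.
Proof.
apply: (mulfI (circle_neq0 z)); rewrite divff ?circle_neq0//.
by rewrite -normCK (eqP (valP z)) expr1n.
Qed.

Lemma circle_expzD z m n : val z ^ (m + n) = val z ^ m * val z ^ n.
Proof. by rewrite expfzDr ?circle_neq0. Qed.

Lemma circle_expzN z n : val z ^ (- n) = (val z ^ n)^*.
Proof.
by rewrite -exprz_inv circle_invE rmorphXz ?unitfE ?circle_neq0.
Qed.

Lemma circle_conj_expz z n : val (circle_conj z) ^ n = val z ^ (- n).
Proof. by rewrite circle_expzN /= rmorphXz ?unitfE ?circle_neq0. Qed.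

Lemma norm_circle_expz z n : `|val z ^ n| = 1.
Proof.
have h (k : nat) : `|val z ^ k%:Z| = 1 by rewrite -exprnP normrX (eqP (valP z)) expr1n.
by case: n => [k|k]; rewrite ?h// NegzE circle_expzN norm_conjC h.
Qed.

Lemma cmeasurable_expz n : cmeasurable (fun z : circle R => val z ^ n).
Proof.
have h (k : nat) : cmeasurable (fun z : circle R => val z ^ k%:Z).
  elim: k => [|k IH]; first exact: cmeasurable_cst.
  under eq_fun do rewrite exprSz.
  exact: (cmeasurableM cmeasurable_val).
case: n => [k|k]; first exact: h.
under eq_fun do rewrite NegzE circle_expzN.
exact/cmeasurableJ/h.
Qed.

Lemma cintegrable_expzM n g : cintegrable g ->
  cintegrable (fun z : circle R => val z ^ n * g z).
Proof.
apply: (@cintegrableMl _ _ _ 1); first exact: cmeasurable_expz.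
by move=> z; apply: ReIm_norm_le1; rewrite norm_circle_expz.
Qed.

Lemma cintegrable_expz n : cintegrable (fun z : circle R => val z ^ n).
Proof.
apply: (@cintegrable_bounded _ _ 1); first exact: cmeasurable_expz.
by move=> z; apply: ReIm_norm_le1; rewrite norm_circle_expz.
Qed.

Lemma circle_expX (t : R) (k : nat) :
  val (circle_exp t) ^+ k = cos (2 * pi * t *+ k) +i* sin (2 * pi * t *+ k).
Proof.
elim: k => [|k IH]; first by rewrite !mulr0n cos0 sin0.
rewrite exprS IH; apply: complex_ext; rewrite ?ReM ?ImM/= (mulrS (2 * pi * t)) ?cosD ?sinD; ring.
Qed.

Lemma integral_cosX (k : nat) : (0 < k)%N ->
  (\int[@lebesgue_measure R]_(t in `[0%R, 1%R]) (1 + cos (2 * pi * t *+ k))%:E = 1)%E.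
Proof.
move=> k0; pose c : R := 2 * pi * k%:R.
have c0 : c != 0 by rewrite /c !mulf_neq0 ?gt_eqF ?pi_gt0 ?ltr0n.
pose F (t : R) : R := t + c^-1 * sin (c * t).
have ct (t : R) : 2 * pi * t *+ k = c * t by rewrite /c -mulr_natr mulrAC.
have dF (t : R) : is_derive t 1 F (1 + cos (c * t)).
  have dc : is_derive t 1 ( *%R c) c.
    by apply: is_derive_eq; rewrite /GRing.scale /= mulr1.
  have ds : is_derive t 1 (@sin R \o *%R c) (c * cos (c * t)).
    rewrite mulrC; apply: is_derive1_comp.
  rewrite (_ : 1 + _ = 1 + c^-1 *: (c * cos (c * t))).
    exact: is_deriveD.
  by rewrite /GRing.scale /= mulrA mulVf// mul1r.
have cont : continuous F.
  by move=> t; apply/differentiable_continuous/derivable1_diffP; exact: ex_derive.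
have cF : {within `[0, 1], continuous (fun t : R => 1 + cos (c * t))}.
  apply: continuous_subspaceT => t; apply: cvgD; first exact: cvg_cst.
  by apply: (continuous_comp (@mulrl_continuous _ c t)); exact: continuous_cos.
under eq_integral do rewrite ct.
rewrite (@continuous_FTC2 _ _ F)//.
- have s0 : sin c = 0.
    have := periodicn (@sinD2pi R) k 0; rewrite sin0 (add0r (pi *+ 2 *+ k)) => <-.
    by congr sin; rewrite /c mulr_natr mulr_natl.
  by rewrite /F !mulr0 mulr1 s0 sin0 mulr0 !addr0 -EFinD subr0.
- split; first by move=> t _; exact: ex_derive.
    by apply: cvg_at_right_filter; exact: cont.
  by apply: cvg_at_left_filter; exact: cont.
- by move=> t _; rewrite derive1E derive_val.
Qed.

(** The real part is integrated after adding 1, as the formula for the uniform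
    law is available for nonnegative functions; the imaginary part vanishes
    because conjugation changes its sign and preserves the measure. *)
Lemma cintegral_expz n : cintegral (fun z : circle R => val z ^ n) = (n == 0)%:R.
Proof.
have pos (k : nat) : (0 < k)%N -> cintegral (fun z : circle R => val z ^ k%:Z) = 0.
  move=> k0; have [i1 i2] := cintegrable_expz k%:Z; have [m1 m2] := cmeasurable_expz k%:Z.
  apply: complex_ext; last first.
    have := cintegral_conj (cintegrable_expz k%:Z).
    under eq_cintegral do rewrite circle_conj_expz circle_expzN.
    rewrite cintegralJ; last exact: cintegrable_expz.
    by move/(congr1 (@complex.Im R)); rewrite ImJ /=; lra.
  have E : \int[mu]_z (1 + Re (val z ^ k%:Z)) = 1.
    rewrite /Rintegral ge0_integral_distribution; last first.
    - move=> z; rewrite lee_fin.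
      have : `|val z ^ k| <= 1 by rewrite norm_circle_expz.
      by move=> /ReIm_norm_le1[+ _]; rewrite ler_norml => /andP[]; lra.
    - by apply/measurable_EFinP; apply: measurable_funD.
    rewrite integral_uniform; last 2 first.
    - apply: measurableT_comp; last exact: measurable_circle_exp.
      by apply/measurable_EFinP; apply: measurable_funD.
    - move=> t /=; rewrite lee_fin.
      have : `|val (circle_exp t) ^ k| <= 1 by rewrite norm_circle_expz.
      by move=> /ReIm_norm_le1[+ _]; rewrite ler_norml => /andP[] /=; lra.
    rewrite subr0 invr1 mul1e -[RHS](congr1 fine (integral_cosX k0)).
    congr fine; apply: eq_integral => t _ /=.
    by rewrite -exprnP -[_ ^+ k]/(val (circle_exp t) ^+ k) circle_expX.
  move: E; rewrite RintegralD//; last exact: finite_measure_integrable_cst.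
  rewrite Rintegral_cst// mul1r /= probability_setT /=; lra.
case: n => [[|k]|k].
- by under eq_cintegral do rewrite expr0z; rewrite cintegral_cst.
- by rewrite pos.
- under eq_cintegral do rewrite NegzE circle_expzN.
  by rewrite cintegralJ ?pos ?rmorph0//; exact: cintegrable_expz.
Qed.

End Characters.

(** * Uniqueness of Fourier coefficients *)

Section Annihilators.
Context {R : realType}.
Local Notation mu := (@circle_measure R).
Implicit Types (z : circle R) (n m : int) (f g : circle R -> R[i]) (u v : circle R -> R).

Definition annihilated f :=
  cintegrable f /\ forall n, cintegral (fun z => val z ^ n * f z) = 0.

(** Annihilated functions are stable under multiplication by annihilators
    ([annihilatedM]); this makes the annihilators an algebra, closed under
    bounded pointwise limits, which contains the real and imaginary parts of z.
    The indicators it contains are therefore those of a sigma-algebra, and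
    these turn out to be all measurable sets. *)
Definition annihilator u :=
  [/\ measurable_fun setT u, exists M, forall z, `|u z| <= M &
      forall f, annihilated f -> cintegral (fun z => (u z)%:C * f z) = 0].

Lemma annihilated_integrableM u f : annihilator u -> cintegrable f ->
  cintegrable (fun z => (u z)%:C * f z).
Proof.
move=> [mu_u [M uM] _] fi; apply: (@cintegrableMl _ _ _ M) => // z.
by rewrite normr0 uM; split=> //; exact: le_trans (uM z).
Qed.

Lemma annihilatedM u f : annihilator u -> annihilated f ->
  annihilated (fun z => (u z)%:C * f z).
Proof.
move=> vu af; have [fi f0] := af; split; first exact: annihilated_integrableM.
move=> n; have [_ _ h] := vu.
rewrite -[RHS](h (fun z => val z ^ n * f z)).
  by apply: eq_cintegral => z; ring.
split; first exact: cintegrable_expzM.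
by move=> m; under eq_cintegral do rewrite mulrA -circle_expzD; exact: f0.
Qed.

Lemma annihilator_cst (r : R) : annihilator (fun=> r).
Proof.
split=> // [|f [fi f0]]; first by exists `|r|.
rewrite cintegralZ//; have := f0 0; under eq_cintegral do rewrite expr0z mul1r.
by move=> ->; rewrite mulr0.
Qed.

Lemma annihilatorD u v : annihilator u -> annihilator v -> annihilator (fun z => u z + v z).
Proof.
move=> vu vv; have [mu_u [M uM] u0] := vu; have [mv [N vN] v0] := vv.
split; first exact: measurable_funD.
  by exists (M + N) => z; rewrite (le_trans (ler_normD _ _))// lerD.
move=> f af; have [fi _] := af.
under eq_cintegral do rewrite rmorphD mulrDl.
rewrite cintegralD ?u0 ?v0 ?addr0//; exact: annihilated_integrableM.
Qed.

Lemma annihilatorM u v : annihilator u -> annihilator v -> annihilator (fun z => u z * v z).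
Proof.
move=> vu vv; have [mu_u [M uM] u0] := vu; have [mv [N vN] v0] := vv.
split; first exact: measurable_funM.
  by exists (M * N) => z; rewrite normrM ler_pM.
move=> f af; rewrite -[RHS](u0 _ (annihilatedM vv af)).
by apply: eq_cintegral => z; rewrite rmorphM mulrA.
Qed.

Lemma annihilatorZ (r : R) u : annihilator u -> annihilator (fun z => r * u z).
Proof. exact/annihilatorM/annihilator_cst. Qed.

Lemma annihilator_lim (w : nat -> circle R -> R) u (M : R) :
  (forall k, annihilator (w k)) -> (forall k z, `|w k z| <= M) ->
  (forall z, w k z @[k --> \oo] --> u z) -> annihilator u.
Proof.
move=> vw wM wu.
have mu_u : measurable_fun setT u.
  by apply: (@measurable_fun_cvg _ _ _ _ w) => [k|z _]; [have [] := vw k|exact: wu].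
have uM z : `|u z| <= M.
  have h : `|w k z| @[k --> \oo] --> `|u z| by apply: cvg_norm; exact: wu.
  rewrite -(cvg_lim _ h)//; apply: limr_le; first by apply/cvg_ex; eexists; exact: h.
  exact: nearW.
split=> //; first by exists M.
move=> f af; have [[f1 f2] _] := af.
have key (p : circle R -> R) : mu.-integrable setT (EFin \o p) ->
    (forall k, \int[mu]_z (w k z * p z) = 0) -> \int[mu]_z (u z * p z) = 0.
  move=> ip w0; have mp : measurable_fun setT p by apply/measurable_EFinP; exact: measurable_int ip.
  have ib : mu.-integrable setT (fun z => (M * `|p z|)%:E).
    by under eq_fun do rewrite EFinM; apply: integrableZl => //; exact: integrable_abse ip.
  have [|||||_ _ h] := @dominated_convergence _ _ _ mu setT measurableT
    (fun k z => (w k z * p z)%:E) (fun z => (u z * p z)%:E) (fun z => (M * `|p z|)%:E).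
  - by move=> k; apply/measurable_EFinP; apply: measurable_funM => //; have [] := vw k.
  - by apply/measurable_EFinP; apply: measurable_funM.
  - apply/nearW => z _; apply: cvg_EFin; first exact: nearW.
    by apply: cvgM; [exact: wu|exact: cvg_cst].
  - exact: ib.
  - by apply/nearW => z k _; rewrite lee_fin normrM ler_wpM2r.
  have e k : (\int[mu]_z (w k z * p z)%:E)%E = 0%E.
    have : (\int[mu]_z (w k z * p z)%:E)%E \is a fin_num.
      apply: integrable_fin_num => //; apply: (le_integrable _ _ _ ib) => //.
        by apply/measurable_EFinP; apply: measurable_funM => //; have [] := vw k.
      move=> z _ /=; rewrite lee_fin normrM [leRHS]ger0_norm ?ler_wpM2r//.
      by rewrite mulr_ge0// (le_trans _ (wM 0%N z)).
    by move=> /fineK <-; have := w0 k; rewrite /Rintegral => ->.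
  by rewrite /= (funext e) in h; rewrite /Rintegral -(cvg_lim _ h)// lim_cst.
have w0 k : cintegral (fun z => (w k z)%:C * f z) = 0.
  by have [_ _] := vw k; apply.
apply: complex_ext => /=.
  under eq_Rintegral do rewrite ReM /= mul0r subr0.
  apply: key => // k; move/(congr1 (@Re R)): (w0 k) => /=.
  by under eq_Rintegral do rewrite ReM /= mul0r subr0.
under eq_Rintegral do rewrite ImM /= mul0r addr0.
apply: key => // k; move/(congr1 (@complex.Im R)): (w0 k) => /=.
by under eq_Rintegral do rewrite ImM /= mul0r addr0.
Qed.

End Annihilators.

(** A polynomial map whose iterates converge to the sign at every point of
    [-1, 1], including 0: the algebra of annihilators is thereby closed under
    u |-> sg u, and contains the indicators of the sets where u > r. *)
Section SignIteration.
Context {R : realType}.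

Definition sign_step (y : R) : R := (3 * y - y ^+ 3) / 2.

Lemma sign_step_le1 (y : R) : `|y| <= 1 -> `|sign_step y| <= 1.
Proof.
rewrite !ler_norml /sign_step => /andP[h1 h2]; apply/andP; split.
  rewrite -subr_ge0; have -> : (3 * y - y ^+ 3) / 2 - -1 = (1 + y) ^+ 2 * (2 - y) / 2 by field.
  by rewrite divr_ge0// mulr_ge0 ?sqr_ge0//; lra.
rewrite -subr_ge0; have -> : 1 - (3 * y - y ^+ 3) / 2 = (1 - y) ^+ 2 * (2 + y) / 2 by field.
by rewrite divr_ge0// mulr_ge0 ?sqr_ge0//; lra.
Qed.

Lemma iter_sign_step_le1 (y : R) k : `|y| <= 1 -> `|iter k sign_step y| <= 1.
Proof. by move=> y1; elim: k => //= k; exact: sign_step_le1. Qed.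

Lemma sign_step_continuous : continuous sign_step.
Proof.
move=> y; apply: cvgM; last exact: cvg_cst.
by apply: cvgB; [apply: cvgM; [exact: cvg_cst|exact: cvg_id]|exact: exprn_continuous].
Qed.

Lemma iter_sign_step_cvg (y : R) : `|y| <= 1 ->
  iter k sign_step y @[k --> \oo] --> Num.sg y.
Proof.
have pos (x : R) : 0 < x -> x <= 1 -> iter k sign_step x @[k --> \oo] --> (1 : R).
  move=> x0 x1.
  have b k : 0 < iter k sign_step x <= 1.
    elim: k => [|k /andP[a c]]; first by rewrite x0 x1.
    have := @sign_step_le1 (iter k sign_step x); rewrite (ger0_norm (ltW a)) => /(_ c).
    rewrite ler_norml iterS => /andP[_ ->]; rewrite andbT.
    rewrite /sign_step; have -> : 3 * iter k sign_step x - iter k sign_step x ^+ 3 =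
      iter k sign_step x * (3 - iter k sign_step x ^+ 2) by ring.
    rewrite divr_gt0// mulr_gt0// subr_gt0.
    by rewrite (@le_lt_trans _ _ 1) ?ltr1n// expr_le1// ltW.
  have nd : {homo (fun k => iter k sign_step x) : n m / (n <= m)%N >-> n <= m}.
    apply/nondecreasing_seqP => k; have /andP[a c] := b k; rewrite iterS.
    move: (iter k _ _) a c => t a c; rewrite /sign_step -subr_ge0.
    have -> : (3 * t - t ^+ 3) / 2 - t = t * (1 - t ^+ 2) / 2 by field.
    by rewrite divr_ge0// mulr_ge0 ?(ltW a)// subr_ge0 expr_le1// ltW.
  have cv : cvgn (fun k => iter k sign_step x).
    by apply: nondecreasing_is_cvgn => //; exists 1 => _ [k _ <-]; have /andP[] := b k.
  set L := limn (fun k => iter k sign_step x).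
  have Lx : x <= L by exact: (nondecreasing_cvgn_le nd cv 0%N).
  have LE : sign_step L = L.
    have h1 : iter k.+1 sign_step x @[k --> \oo] --> L.
      by rewrite (cvg_shiftS (fun k => iter k sign_step x)).
    have h2 : sign_step (iter k sign_step x) @[k --> \oo] --> sign_step L.
      exact: (continuous_cvg _ (@sign_step_continuous L) cv).
    exact: norm_cvg_unique h2 h1.
  have L0 : 0 < L by exact: lt_le_trans Lx.
  have : L * ((1 - L) * (1 + L)) = 0.
    by move/eqP: LE; rewrite /sign_step -subr_eq0 => /eqP h; rewrite -[RHS](mulr0 2) -h; field.
  move/eqP; rewrite !mulf_eq0 (gt_eqF L0) (gt_eqF (addr_gt0 ltr01 L0)) orbF subr_eq0 => /eqP e.
  by rewrite e; exact: cv.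
have odd (x : R) k : iter k sign_step (- x) = - iter k sign_step x.
  by elim: k => //= k ->; rewrite /sign_step; field.
move=> y1; case: (ltgtP y 0) => y0.
- rewrite ltr0_sg// (_ : (fun k => _) = (fun k => - iter k sign_step (- y))).
    by apply: cvgN; apply: pos; rewrite ?oppr_gt0//; rewrite ltr0_norm in y1.
  by apply/funext => k; rewrite odd opprK.
- by rewrite gtr0_sg//; apply: pos => //; rewrite gtr0_norm in y1.
- rewrite y0 sgr0 (_ : (fun k => _) = (fun=> 0)); first exact: cvg_cst.
  by apply/funext; elim => //= k ->; rewrite /sign_step; field.
Qed.

End SignIteration.

Section FourierUniqueness.
Context {R : realType}.
Local Notation mu := (@circle_measure R).
Implicit Types (z : circle R) (n m : int) (f g : circle R -> R[i]) (u v : circle R -> R).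

Lemma annihilator_Re : annihilator (fun z : circle R => Re (val z)).
Proof.
have [m1 m2] := @cmeasurable_val R.
split=> //.
  by exists 1 => z; have [] := @ReIm_norm_le1 _ (val z); rewrite ?(eqP (valP z)).
move=> f [fi f0].
transitivity (cintegral (fun z => 2^-1 * (val z ^ 1 * f z + val z ^ (-1) * f z))).
  apply: eq_cintegral => z; rewrite circle_expzN -mulrDl mulrA; congr (_ * _).
  rewrite expr1z -realCV2.
  by apply: complex_ext; rewrite ?ReM ?ImM ?ReD ?ImD ?ReJ ?ImJ /=; field.
rewrite cintegralZ ?cintegralD ?f0 ?addr0 ?mulr0//; try exact: cintegrable_expzM.
by apply: cintegrableD; exact: cintegrable_expzM.
Qed.

Lemma annihilator_Im : annihilator (fun z : circle R => Im (val z)).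
Proof.
have [m1 m2] := @cmeasurable_val R.
split=> //.
  by exists 1 => z; have [] := @ReIm_norm_le1 _ (val z); rewrite ?(eqP (valP z)).
move=> f [fi f0].
transitivity (cintegral (fun z => (- 'i * 2^-1) * (val z ^ 1 * f z + -1 * (val z ^ (-1) * f z)))).
  apply: eq_cintegral => z; rewrite circle_expzN mulrA -mulrDl mulrA; congr (_ * _).
  rewrite expr1z -realCV2.
  by apply: complex_ext; rewrite ?ReM ?ImM ?ReN ?ImN ?ReD ?ImD ?ReM ?ImM ?ReJ ?ImJ /=; field.
have i1 := cintegrable_expzM 1 fi; have i2 := cintegrable_expzM (-1) fi.
have i3 := cintegrableZ (-1) i2.
rewrite cintegralZ ?cintegralD ?cintegralZ ?f0 ?mulr0 ?addr0 ?mulr0//.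
exact: cintegrableD.
Qed.

Lemma annihilator_sg u : annihilator u -> annihilator (fun z => Num.sg (u z)).
Proof.
move=> vu; have [_ [M uM] _] := vu.
pose c := (`|M| + 1)^-1; have c0 : 0 < c by rewrite invr_gt0 ltr_wpDl.
have cu z : `|c * u z| <= 1.
  rewrite normrM (gtr0_norm c0) mulrC ler_pdivrMr ?ltr_wpDl// mul1r.
  by rewrite (le_trans (uM z))// (le_trans (ler_norm M))// lerDl.
apply: (@annihilator_lim _ (fun k z => iter k (@sign_step R) (c * u z)) _ 1).
- elim => [|k IH]; first exact: annihilatorZ.
  under eq_fun do rewrite iterS.
  have -> : (fun z => sign_step (iter k (@sign_step R) (c * u z))) = fun z =>
     2^-1 * (3 * iter k (@sign_step R) (c * u z) + -1 * (iter k (@sign_step R) (c * u z) *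
       (iter k (@sign_step R) (c * u z) * iter k (@sign_step R) (c * u z)))).
    by apply/funext => z; rewrite /sign_step; field.
  apply: annihilatorZ; apply: annihilatorD; apply: annihilatorZ => //.
  by apply: annihilatorM => //; exact: annihilatorM.
- by move=> k z; exact: iter_sign_step_le1.
- by move=> z; have := iter_sign_step_cvg (cu z); rewrite sgrM (gtr0_sg c0) mul1r.
Qed.

Lemma annihilator_gt u (r : R) : annihilator u -> annihilator (\1_[set z | r < u z]).
Proof.
move=> vu; have vs : annihilator (fun z => Num.sg (u z + - r)).
  by apply: annihilator_sg; apply: annihilatorD => //; exact: annihilator_cst.
have -> : \1_[set z | r < u z] = fun z =>
    2^-1 * (Num.sg (u z - r) * Num.sg (u z - r) + Num.sg (u z - r)) :> R.
  apply/funext => z; rewrite indicE.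
  case: (sgrP (u z - r)) => h; rewrite ?mul0r ?mulr1 ?mulrN1 ?opprK ?addr0 ?mulr0 ?subrr ?mulr0.
  - by rewrite memNset//= => h'; lra.
  - by rewrite mem_set /=; [field|rewrite -subr_gt0].
  - by rewrite memNset ?subrr ?addNr ?mulr0//= => h'; lra.
by apply: annihilatorZ; apply: annihilatorD => //; exact: annihilatorM.
Qed.

Definition annihilating_sets : set (set (circle R)) := [set E | annihilator (\1_E)].

Lemma sigma_algebra_annihilating : sigma_algebra setT annihilating_sets.
Proof.
split.
- rewrite /annihilating_sets/= indic0; exact: annihilator_cst.
- move=> A vA; rewrite /annihilating_sets/=.
  have -> : \1_(setT `\` A) = fun z => 1 + -1 * \1_A z :> R.
    apply/funext => z; rewrite setTD !indicE in_setC; case: (z \in A) => /=; ring.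
  by apply: annihilatorD; [exact: annihilator_cst|exact: annihilatorZ].
- move=> F vF; rewrite /annihilating_sets/=.
  apply: (@annihilator_lim _ (fun k z => 1 + -1 * \prod_(i < k) (1 + -1 * \1_(F i) z)) _ 1).
  + move=> k; apply: annihilatorD; first exact: annihilator_cst.
    apply: annihilatorZ; elim: k => [|k IH].
      by under eq_fun do rewrite big_ord0; exact: annihilator_cst.
    under eq_fun do rewrite big_ord_recr/=.
    apply: annihilatorM => //; apply: annihilatorD; first exact: annihilator_cst.
    by apply: annihilatorZ; exact: vF.
  + move=> k z; have : 0 <= \prod_(i < k) (1 + -1 * \1_(F i) z : R) <= 1.
      elim: k => [|k]; first by rewrite big_ord0 ler01 lexx.
      rewrite big_ord_recr /= indicE; move: (\prod_(i < k) _) => t.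
      by case: (z \in _) => /= ?; apply/andP; split; lra.
    by move=> /andP[h1 h2]; rewrite ler_norml; apply/andP; split; lra.
  + move=> z; have [[i _ Fiz]|nF] := pselect ((\bigcup_k F k) z).
      rewrite indicE mem_set; last by exists i.
      apply: cvg_near_cst; exists i.+1 => // k /= ik.
      rewrite (bigD1 (Ordinal ik))//= indicE mem_set//=; ring.
    rewrite indicE memNset// (_ : (fun k => _) = fun=> 0); first exact: cvg_cst.
    apply/funext => k; rewrite big1 ?mulr1 ?subrr ?addrN// => i _.
    by rewrite indicE memNset ?mulr0 ?addr0// => Fi; apply: nF; exists i.
Qed.

Lemma annihilator_preimage u (A : set R) : annihilator u -> measurable A -> annihilating_sets (u @^-1` A).
Proof.
move=> vu; pose G := image_set_system setT u annihilating_sets.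
have sG : sigma_algebra setT G by exact/sigma_algebra_image/sigma_algebra_annihilating.
rewrite -[X in annihilating_sets X]setTI.
suff : measurable `<=` G by apply.
rewrite [X in X `<=` _](RGenOInfty.measurableE R).
apply: smallest_sub => // _ [x ->].
rewrite /G /image_set_system/= setTI.
rewrite (_ : _ @^-1` _ = [set z | x < u z]); first exact: annihilator_gt.
by apply/seteqP; split => z /=; rewrite in_itv/= andbT.
Qed.

Lemma measurable_annihilating : @measurable _ (circle R) `<=` annihilating_sets.
Proof.
move=> _ [B mB <-].
suff : measurable `<=` image_set_system setT (@circle_coord R) annihilating_sets by apply.
apply: smallest_sub; first exact/sigma_algebra_image/sigma_algebra_annihilating.
by move=> _ [[A mA <-]|[A mA <-]]; rewrite /image_set_system/= !setTI;
  [exact: (annihilator_preimage annihilator_Re)|exact: (annihilator_preimage annihilator_Im)].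
Qed.

(** Every indicator of a measurable set is an annihilator, so f has integral 0
    over every measurable set. *)
Lemma fourier_uniqueness f : cintegrable f ->
  (forall n, cintegral (fun z => val z ^ n * f z) = 0) ->
  \forall z \ae mu, f z = 0.
Proof.
move=> fi f0; have [f1 f2] := fi.
have v0 E : measurable E -> cintegral (fun z => (\1_E z)%:C * f z) = 0.
  by move=> /measurable_annihilating[_ _]; apply.
have key (p : circle R -> R) : mu.-integrable setT (fun z => (p z)%:E) ->
    (forall E, measurable E -> \int[mu]_z (\1_E z * p z) = 0) -> \forall z \ae mu, p z = 0.
  move=> ip p0.
  have : ae_eq mu setT (fun z => (p z)%:E) (cst 0%E).
    apply: integral_ae_eq => // E _ mE.
    rewrite integral0 integral_mkcond.
    rewrite -[LHS]fineK; last first.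
      by apply: integrable_fin_num => //; rewrite -integrable_mkcond//; exact: integrableS ip.
    congr EFin; rewrite -(p0 E mE) /Rintegral; congr fine; apply: eq_integral => z _.
    by rewrite patchE indicE; case: ifPn => /=; rewrite ?mul1r ?mul0r.
  by apply: filterS => z /(_ Logic.I)[].
have h1 : \forall z \ae mu, Re (f z) = 0.
  apply: key => // E mE; move/(congr1 (@Re R)): (v0 E mE) => /=.
  by under eq_Rintegral do rewrite ReM /= mul0r subr0.
have h2 : \forall z \ae mu, Im (f z) = 0.
  apply: key => // E mE; move/(congr1 (@complex.Im R)): (v0 E mE) => /=.
  by under eq_Rintegral do rewrite ImM /= mul0r addr0.
by apply: filterS2 h1 h2 => z e1 e2; exact: complex_ext.
Qed.

End FourierUniqueness.

(** * Weak measurability *)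

Section WeakMeasurability.
Context {R : realType} {K : hilbertType R}.
Local Notation mu := (@circle_measure R).
Implicit Types (x y w : K) (f g : circle R -> K) (a : R[i]) (r : R).

Lemma nbhs_hnorm x (P : set K) :
  nbhs x P <-> exists2 e : R, 0 < e & forall y, hnorm (x - y) < e -> P y.
Proof.
split=> [/nbhs_ballP[e /= e0 eP]|[e e0 eP]].
  have eE : e = (Re e)%:C by rewrite RRe_real// gtr0_real.
  exists (Re e); first by rewrite -ltcR -eE.
  by move=> y h; apply: eP; rewrite -ball_normE/= hnormE eE ltcR.
apply/nbhs_ballP; exists e%:C => /=; first by rewrite ltcR.
by move=> y; rewrite -ball_normE/= hnormE ltcR; exact: eP.
Qed.

Lemma open_lipschitz (phi : K -> R) (C r : R) :
  (forall x y, phi x - phi y <= C * hnorm (x - y)) -> open [set x | r < phi x].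
Proof.
move=> phiC; rewrite openE => x /= rx; apply/nbhs_hnorm.
have C0 : 0 < `|C| + 1 by rewrite ltr_wpDl.
exists ((phi x - r) / (`|C| + 1)); first by rewrite divr_gt0// subr_gt0.
move=> y; rewrite ltr_pdivlMr// => h.
have := phiC x y; have := hnorm_ge0 (x - y) => h1 h2.
have : C * hnorm (x - y) <= `|C| * hnorm (x - y) by rewrite ler_wpM2r// ler_norm.
move=> h3 /=; rewrite mulrDr mulr1 in h; lra.
Qed.

Lemma separable_seq : separable K -> exists d : nat -> K,
  forall O : set K, open O -> O !=set0 -> exists n, O (d n).
Proof.
move=> [D /countable_injP[g gi] dD].
exists (fun n => xget 0 [set x | D x /\ g x = n]) => O oO O0.
have [x [Ox Dx]] := dD O O0 oO.
exists (g x); case: xgetP => [y _ [Dy gy]|/(_ x)]; last by case.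
by rewrite (gi y x) ?inE.
Qed.

Lemma lipschitz_Re_dot w x y : Re (dot x w) - Re (dot y w) <= hnorm w * hnorm (x - y).
Proof. by rewrite -ReN -ReD -dotBl mulrC Re_dot_le. Qed.

Lemma lipschitz_hnorm x y : hnorm x - hnorm y <= hnorm (x - y).
Proof. by have := ler_hnormD (x - y) y; rewrite subrK; lra. Qed.

(** Equivalent to Borel measurability in a separable space, but stable by
    construction under linear operations. *)
Definition wmeasurable f := forall w, cmeasurable (fun z => dot (f z) w).

Lemma Im_dot x y : Im (dot x y) = - Re (dot ('i *: x) y).
Proof. by rewrite dotZl ReM /= mul0r mul1r sub0r opprK. Qed.

Lemma wmeasurable_Re f : (forall w, measurable_fun setT (fun z => Re (dot (f z) w))) ->
  wmeasurable f.
Proof.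
move=> mf w; split; first exact: mf.
have e z : Im (dot (f z) w) = Re (dot (f z) ('i *: w)).
  by rewrite dotZr conji mulNr ReN ReM /= mul0r mul1r sub0r opprK.
by rewrite (funext e).
Qed.

Lemma borel_wmeasurable f : borel_measurable f -> wmeasurable f.
Proof.
move=> mf; apply: wmeasurable_Re => w.
apply: (measurability _ (RGenOInfty.measurableE R)) => _ [_ [r ->] <-].
rewrite setTI.
have -> : (fun z => Re (dot (f z) w)) @^-1` `]r, +oo[%classic = f @^-1` [set x | r < Re (dot x w)].
  by apply/seteqP; split=> z /=; rewrite in_itv/= andbT.
rewrite -[X in measurable X]setTI; apply: mf => //.
apply: sub_sigma_algebra; exact: (open_lipschitz r (lipschitz_Re_dot w)).
Qed.

Lemma wmeasurableD f g : wmeasurable f -> wmeasurable g -> wmeasurable (fun z => f z + g z).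
Proof. by move=> mf mg w; under eq_fun do rewrite dotDl; exact: cmeasurableD. Qed.

Lemma wmeasurableZ (h : circle R -> R[i]) f : cmeasurable h -> wmeasurable f ->
  wmeasurable (fun z => h z *: f z).
Proof. by move=> mh mf w; under eq_fun do rewrite dotZl; exact: cmeasurableM. Qed.

Lemma wmeasurable_cst x : wmeasurable (fun=> x).
Proof. by move=> w; exact: cmeasurable_cst. Qed.

Hypothesis sepK : separable K.

(** For r >= 0 and a dense sequence d, |x| > r if and only if
    r |d n| < Re <x, d n> for some n: one direction is Cauchy-Schwarz, and the
    other holds because this is an open condition on d n satisfied by x. *)
Lemma measurable_hnorm f : wmeasurable f -> measurable_fun setT (fun z => hnorm (f z)).
Proof.
move=> mf; have [d dP] := separable_seq sepK.
apply: (measurability _ (RGenOInfty.measurableE R)) => _ [_ [r ->] <-].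
rewrite setTI.
have [r0|r0] := ltP r 0.
  rewrite (_ : _ @^-1` _ = setT)//; apply/seteqP; split=> z //= _.
  by rewrite in_itv/= andbT (lt_le_trans r0)// hnorm_ge0.
have -> : (fun z => hnorm (f z)) @^-1` `]r, +oo[%classic =
    \bigcup_n [set z | r * hnorm (d n) < Re (dot (f z) (d n))].
  apply/seteqP; split=> z /=; rewrite in_itv/= andbT.
    move=> rz.
    have [||n /= h] := dP [set x | 0 < Re (dot x (f z)) - r * hnorm x].
    - apply: (@open_lipschitz _ (hnorm (f z) + r)) => x y.
      have h1 := lipschitz_Re_dot (f z) x y; have := lipschitz_hnorm y x.
      rewrite -(hnormN (y - x)) opprB => h2.
      have : r * (hnorm y - hnorm x) <= r * hnorm (x - y) by rewrite ler_wpM2l.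
      lra.
    - exists (f z) => /=; rewrite -sqr_hnorm subr_gt0 expr2 ltr_pM2r//.
      exact: le_lt_trans rz.
    - exists n => //=; rewrite -subr_gt0 dotC; move: h; by case: (dot _ _).
  move=> [n _ /= h].
  have := le_trans (ltW h) (Re_dot_le (f z) (d n)).
  have [d0|d0] := eqVneq (hnorm (d n)) 0.
    move: h; rewrite (hnorm_eq0 d0) dot0r /= hnorm0 mulr0 ltxx//.
  have dp : 0 < hnorm (d n) by rewrite lt_neqAle eq_sym d0 hnorm_ge0.
  by move=> _; have := lt_le_trans h (Re_dot_le (f z) (d n)); rewrite ltr_pM2r.
apply: bigcupT_measurable => n.
rewrite -[X in measurable X]setTI.
have [m1 _] := mf (d n).
have -> : [set z | r * hnorm (d n) < Re (dot (f z) (d n))] =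
   (fun z => Re (dot (f z) (d n))) @^-1` `]r * hnorm (d n), +oo[%classic.
  by apply/seteqP; split=> z /=; rewrite in_itv/= andbT.
exact: m1.
Qed.

(** An open set is a countable union of balls centred on a dense sequence, and
    the preimage of a ball is described by a norm. *)
Lemma wmeasurable_borel f : wmeasurable f -> borel_measurable f.
Proof.
move=> mf; have [d dP] := separable_seq sepK.
suff oP : @open K `<=` image_set_system setT f (@measurable _ (circle R)).
  move=> _ V; apply: (smallest_sub _ oP).
  by apply: sigma_algebra_image; exact: sigma_algebra_measurable.
move=> V oV; rewrite /image_set_system/= setTI.

pose B n m := [set y | hnorm (y - d n) < m.+1%:R^-1].
have -> : f @^-1` V = \bigcup_n \bigcup_m
    (if `[< B n m `<=` V >] then f @^-1` (B n m) else set0).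
  apply/seteqP; split=> z /=; last first.
    by move=> [n _ [m _]]; case: asboolP => // BV; exact: BV.
  move=> Vz; move: oV; rewrite openE => /(_ _ Vz)/nbhs_hnorm[e e0 eV].
  have e2 : 0 < e / 2 by rewrite divr_gt0.
  have [m] := ltr_add_invr e2.
  rewrite add0r => me.
  have [||n /= hn] := dP [set y | - (m.+1%:R^-1) < - hnorm (f z - y)].
  - apply: (@open_lipschitz _ 1) => x y.
    have -> : x - y = (f z - y) - (f z - x) by rewrite opprB [RHS]addrC addrA subrK.
    by have := lipschitz_hnorm (f z - y) (f z - x); lra.
  - by exists (f z) => /=; rewrite subrr hnorm0 oppr0 oppr_lt0 invr_gt0.
  exists n => //; exists m => //; rewrite ltrN2 in hn.
  rewrite asboolT//= => y; rewrite /B/= => hy; apply: eV.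
  have := ler_hnormB (f z - d n) (y - d n).
  rewrite opprB addrA subrK ; move: me hn hy; move: (m.+1%:R^-1) => t; lra.
apply: bigcupT_measurable => n; apply: bigcupT_measurable => m; case: ifP => _ //.
have mh : measurable_fun setT (fun z => hnorm (f z - d n)).
  apply: measurable_hnorm; apply: wmeasurableD => //; exact: wmeasurable_cst.
rewrite -[X in measurable X]setTI.
have -> : f @^-1` B n m = (fun z => hnorm (f z - d n)) @^-1` `]-oo, m.+1%:R^-1[%classic.
  by apply/seteqP; split=> z /=; rewrite in_itv/=.
exact: mh.
Qed.

(** By polarization. *)
Lemma cmeasurable_dot f g : wmeasurable f -> wmeasurable g ->
  cmeasurable (fun z => dot (f z) (g z)).
Proof.
have h f' g' : wmeasurable f' -> wmeasurable g' ->
    measurable_fun setT (fun z => Re (dot (f' z) (g' z))).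
  move=> mf mg.
  have e z : Re (dot (f' z) (g' z)) =
      4^-1 * (hnorm (f' z + g' z) ^+ 2 - hnorm (f' z + -1 *: g' z) ^+ 2).
    by rewrite scaleN1r sqr_hnormB sqr_hnormD; field.
  rewrite (funext e); apply: measurable_funM => //; apply: measurable_funB;
    apply: measurable_funX; apply: measurable_hnorm; apply: wmeasurableD => //.
  by apply: wmeasurableZ => //; exact: cmeasurable_cst.
move=> mf mg; split; first exact: h.
under eq_fun do rewrite Im_dot.
apply: measurableT_comp => //; apply: h => //.
by apply: wmeasurableZ => //; exact: cmeasurable_cst.
Qed.

End WeakMeasurability.

(** * Vector-valued Fourier coefficients and the Hardy space *)

Section SquareIntegrable.
Context {R : realType} {K : hilbertType R}.
Local Notation mu := (@circle_measure R).
Implicit Types (x y v w : K) (f g h : circle R -> K) (a : R[i]) (r : R) (n : int).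
Implicit Types (Q P : circle R -> bop K).

Lemma ae_ex (S : circle R -> Prop) : (\forall z \ae mu, S z) -> exists z, S z.
Proof.
move=> [N [mN N0 SN]]; apply: contrapT => /forallNP nS.
have NT : N = setT by apply/seteqP; split=> // z _; apply: SN; exact: nS.
by move: N0; rewrite NT probability_setT => /eqP; rewrite onee_eq0.
Qed.

Definition sqint f :=
  wmeasurable f /\ mu.-integrable setT (fun z => (hnorm (f z) ^+ 2)%:E).

Lemma Re_dot_norm x y : `|Re (dot x y)| <= hnorm x * hnorm y.
Proof.
rewrite ler_norml Re_dot_le andbT; have := Re_dot_le (- x) y.
by rewrite dotNl ReN hnormN; lra.
Qed.

Lemma Im_dot_norm x y : `|Im (dot x y)| <= hnorm x * hnorm y.
Proof.
rewrite Im_dot normrN (le_trans (Re_dot_norm _ _))//.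
by rewrite hnormZ normc_def/= expr0n/= expr1n add0r sqrtr1 mul1r.
Qed.

Hypothesis sepK : separable K.

Lemma L2_sqint f : L2 f <-> sqint f.
Proof.
split=> [[mf fi]|[mf fi]].
  have wf := borel_wmeasurable mf; split => //; apply/integrableP; split.
    by apply/measurable_EFinP; apply: measurable_funX; exact: measurable_hnorm.
  by under eq_integral do rewrite /= ger0_norm ?sqr_ge0//.
split; first exact: wmeasurable_borel.
move/integrableP : fi => [_]; under eq_integral do rewrite /= ger0_norm ?sqr_ge0//.
by [].
Qed.

Lemma sqint_dom f g (M : R) : wmeasurable f -> sqint g ->
  (\forall z \ae mu, hnorm (f z) <= M * hnorm (g z)) -> sqint f.
Proof.
move=> wf [wg gi] fg; split=> //.
have mf := measurable_hnorm sepK wf; have mg := measurable_hnorm sepK wg.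
apply/integrableP; split.
  by apply/measurable_EFinP; apply: measurable_funX.
have ib : mu.-integrable setT (fun z => (M ^+ 2 * hnorm (g z) ^+ 2)%:E).
  by under eq_fun do rewrite EFinM; exact: integrableZl.
move/integrableP : (ib) => [mb]; apply: le_lt_trans.
apply: ae_ge0_le_integral => //.
- by apply: measurableT_comp => //; apply/measurable_EFinP; apply: measurable_funX.
- exact: measurableT_comp.
- apply: filterS fg => z h _; rewrite lee_fin -exprMn !ger0_norm ?sqr_ge0//.
  by rewrite ler_pXn2r ?nnegrE ?hnorm_ge0// (le_trans (hnorm_ge0 _) h).
Qed.

Lemma sqint_cst v : sqint (fun=> v).
Proof.
split; first exact: wmeasurable_cst.
exact: finite_measure_integrable_cst.
Qed.

Lemma sqintD f g : sqint f -> sqint g -> sqint (fun z => f z + g z).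
Proof.
move=> [wf fi] [wg gi]; split; first exact: wmeasurableD.
have ib : mu.-integrable setT (fun z => (2 * hnorm (f z) ^+ 2 + 2 * hnorm (g z) ^+ 2)%:E).
  by under eq_fun do rewrite EFinD !EFinM; apply: integrableD => //; exact: integrableZl.
apply: (le_integrable _ _ _ ib) => //.
  apply/measurable_EFinP; apply: measurable_funX; apply: measurable_hnorm => //.
  exact: wmeasurableD.
move=> z _; rewrite lee_fin ger0_norm ?sqr_ge0// [leRHS]ger0_norm; last first.
  by have := sqr_ge0 (hnorm (f z)); have := sqr_ge0 (hnorm (g z)); lra.
have := ler_hnormD (f z) (g z); move: (hnorm_ge0 (f z + g z)).
move: (hnorm _) (hnorm _) (hnorm _) => t u s s0 h.
have : s ^+ 2 <= (u + t) ^+ 2 by rewrite ler_pXn2r ?nnegrE// (le_trans s0 h).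
by have := sqr_ge0 (t - u); lra.
Qed.

Lemma sqintM (p : circle R -> R[i]) f : cmeasurable p ->
  (forall z, `|p z| <= 1) -> sqint f -> sqint (fun z => p z *: f z).
Proof.
move=> mp p1 sf; apply: (@sqint_dom _ f 1) => //.
  by apply: wmeasurableZ => //; case: sf.
apply: nearW => z; rewrite hnormZ ler_wpM2r ?hnorm_ge0//.
by rewrite -lecR RRe_real ?normr_real.
Qed.

Lemma sqint_expz n f : sqint f -> sqint (fun z => val z ^ n *: f z).
Proof.
move=> sf; apply: sqintM => //; first exact: cmeasurable_expz.
by move=> z; rewrite norm_circle_expz.
Qed.

Lemma sqint_bop (B : bop K) f : sqint f -> sqint (fun z => B (f z)).
Proof.
move=> sf; have [M M0 BM] := bop_bounded B.
apply: (@sqint_dom _ f M) => //; last by apply: nearW.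
by move=> w; under eq_fun do rewrite adjP; case: sf => wf _; exact: wf.
Qed.

Lemma cintegrable_dot f g : sqint f -> sqint g -> cintegrable (fun z => dot (f z) (g z)).
Proof.
move=> [wf fi] [wg gi].
apply: (@cintegrable_dom _ _ (fun z => hnorm (f z) ^+ 2 + hnorm (g z) ^+ 2)).
- exact: cmeasurable_dot.
- by under eq_fun do rewrite EFinD; exact: integrableD.
- move=> z; have h : hnorm (f z) * hnorm (g z) <= hnorm (f z) ^+ 2 + hnorm (g z) ^+ 2.
    move: (hnorm_ge0 (f z)) (hnorm_ge0 (g z)); move: (hnorm _) (hnorm _) => s t s0 t0; nra.
  by split; apply: le_trans h; [exact: Re_dot_norm|exact: Im_dot_norm].
Qed.

Lemma cintegrable_dotw f w : sqint f -> cintegrable (fun z => dot (f z) w).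
Proof. by move=> sf; apply: (@cintegrable_dot f (fun=> w)) => //; exact: sqint_cst. Qed.

(** The n-th Fourier coefficient of f paired with w. Working with these scalars
    postpones the existence of the coefficient as a vector, which is needed
    only for n = 0 ([mean_exists]). *)
Definition fcoef f n w : R[i] := cintegral (fun z => val z ^ (- n) * dot (f z) w).

Lemma hardyE f : hardy f <-> sqint f /\ forall n w, n < 0 -> fcoef f n w = 0.
Proof.
split=> [[/L2_sqint sf h]|[/L2_sqint sf h]]; split=> // n.
  by move=> w n0; have := h n n0 w; rewrite dot0l.
by move=> n0 w; rewrite dot0l; exact/esym/h.
Qed.

Lemma fcoefD f g n w : sqint f -> sqint g ->
  fcoef (fun z => f z + g z) n w = fcoef f n w + fcoef g n w.
Proof.
move=> sf sg; rewrite /fcoef; under eq_cintegral do rewrite dotDl mulrDr.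
by rewrite cintegralD//; apply: cintegrable_expzM; exact: cintegrable_dotw.
Qed.

Lemma fcoef_expz f n m w : fcoef (fun z => val z ^ m *: f z) n w = fcoef f (n - m) w.
Proof.
by apply: eq_cintegral => z; rewrite dotZl mulrA -circle_expzD; congr (_ ^ _ * _); lia.
Qed.

Lemma fcoef_bop (B : bop K) f n w : fcoef (fun z => B (f z)) n w = fcoef f n (adj B w).
Proof. by apply: eq_cintegral => z; rewrite adjP. Qed.

Lemma fcoef_cst v n w : fcoef (fun=> v) n w = (n == 0)%:R * dot v w.
Proof.
rewrite /fcoef; under eq_cintegral do rewrite mulrC.
by rewrite cintegralZ ?cintegral_expz ?oppr_eq0 1?mulrC//; exact: cintegrable_expz.
Qed.

Lemma fcoefZ a f n w : sqint f -> fcoef (fun z => a *: f z) n w = a * fcoef f n w.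
Proof.
move=> sf; rewrite /fcoef; under eq_cintegral do rewrite dotZl mulrCA.
by rewrite cintegralZ//; apply: cintegrable_expzM; exact: cintegrable_dotw.
Qed.

Lemma ae_fcoef f g n w : wmeasurable f -> wmeasurable g ->
  (\forall z \ae mu, f z = g z) -> fcoef f n w = fcoef g n w.
Proof.
move=> wf wg fg; apply: ae_eq_cintegral.
- by apply: cmeasurableM; [exact: cmeasurable_expz|exact: wf].
- by apply: cmeasurableM; [exact: cmeasurable_expz|exact: wg].
- by apply: filterS fg => z ->.
Qed.

Lemma ae_hardy f g : wmeasurable g -> (\forall z \ae mu, f z = g z) -> hardy f -> hardy g.
Proof.
move=> wg fg /hardyE[[wf fi] h]; apply/hardyE; split.
  by apply: (@sqint_dom _ f 1) => //; apply: filterS fg => z ->; rewrite mul1r.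
by move=> n w n0; rewrite -(ae_fcoef n w wf wg fg) h.
Qed.

Lemma hardy_cst v : hardy (fun=> v).
Proof.
apply/hardyE; split; first exact: sqint_cst.
by move=> n w n0; rewrite fcoef_cst lt_eqF// mul0r.
Qed.

Lemma hardy_bop (B : bop K) f : hardy f -> hardy (fun z => B (f z)).
Proof.
move=> /hardyE[sf h]; apply/hardyE; split; first exact: sqint_bop.
by move=> n w n0; rewrite fcoef_bop h.
Qed.

Lemma dense_eq0 (d : nat -> K) : (forall O : set K, open O -> O !=set0 -> exists k, O (d k)) ->
  forall x, (forall k, dot x (d k) = 0) -> x = 0.
Proof.
move=> dP x xd; apply: contrapT => /eqP x0.
have xp : 0 < hnorm x.
  by rewrite lt_neqAle hnorm_ge0 andbT eq_sym; apply/eqP => /hnorm_eq0/eqP; exact/negP.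
have [||k /=] := dP [set y | 0 < Re (dot y x)].
- exact: (open_lipschitz 0 (lipschitz_Re_dot x)).
- by exists x => /=; rewrite -sqr_hnorm exprn_gt0.
- by rewrite dotC xd conjC0 ltxx.
Qed.

Lemma ae_eq0_of_dot f : sqint f -> (forall w, \forall z \ae mu, dot (f z) w = 0) ->
  \forall z \ae mu, f z = 0.
Proof.
move=> sf f0; have [d dP] := separable_seq sepK.
have : \forall z \ae mu, forall k, dot (f z) (d k) = 0.
  by apply/ae_foralln => k; exact: f0.
by apply: filterS => z h; exact: dense_eq0 dP _ h.
Qed.

Lemma fcoef_uniqueness f g : sqint f -> sqint g ->
  (forall n w, fcoef f n w = fcoef g n w) -> \forall z \ae mu, f z = g z.
Proof.
move=> sf sg fg; have sg' : sqint (fun z => -1 *: g z).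
  by apply: (@sqintM (fun=> -1)) => // z; rewrite normrN1.
have : \forall z \ae mu, f z + -1 *: g z = 0.
  apply: ae_eq0_of_dot; first exact: sqintD.
  move=> w; apply: fourier_uniqueness.
    by apply: cintegrable_dotw; exact: sqintD.
  move=> n; have := fcoefD (- n) w sf sg'; rewrite fcoefZ// fg mulN1r subrr /fcoef opprK.
  exact.
by apply: filterS => z /eqP; rewrite scaleN1r subr_eq0 => /eqP.
Qed.

Lemma dense_eq_bop (d : nat -> K) (A B : bop K) :
  (forall O : set K, open O -> O !=set0 -> exists k, O (d k)) ->
  (forall k, A (d k) = B (d k)) -> A = B.
Proof.
move=> dP h; apply: bop_ext => x; apply: contrapT => /eqP xne.
have [C CP] := bop_comb_exists 1 (-1) A B.
have {}CP y : C y = A y - B y by rewrite CP scale1r scaleN1r.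
have [M M0 CM] := bop_bounded C.
have [||k /=] := dP [set y | 0 < hnorm (C y)].
- apply: (@open_lipschitz _ _ _ M) => u v.
  by rewrite (le_trans (lipschitz_hnorm _ _))// -linearB.
- exists x => /=; rewrite lt_neqAle hnorm_ge0 andbT eq_sym; apply/eqP => /hnorm_eq0.
  by rewrite CP => /eqP; rewrite subr_eq0; exact/negP.
- by rewrite CP h subrr hnorm0 ltxx.
Qed.

(** The exceptional set depends on v; a dense sequence of vectors and the
    continuity of operators yield a common one. *)
Lemma ae_eq_bop (P Q : circle R -> bop K) :
  (forall v, \forall z \ae mu, P z v = Q z v) -> \forall z \ae mu, P z = Q z.
Proof.
move=> PQ; have [d dP] := separable_seq sepK.
have : \forall z \ae mu, forall k, P z (d k) = Q z (d k).
  by apply/ae_foralln => k; exact: PQ.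
by apply: filterS => z h; exact: dense_eq_bop dP h.
Qed.

Lemma ae_constant (p : circle R -> R[i]) : cintegrable p ->
  (forall n, n != 0 -> cintegral (fun z => val z ^ n * p z) = 0) ->
  \forall z \ae mu, p z = cintegral p.
Proof.
move=> ip p0; have ic := cintegrable_cst (- cintegral p).
have : \forall z \ae mu, p z + - cintegral p = 0.
  apply: fourier_uniqueness; first exact: cintegrableD.
  move=> n; under eq_cintegral do rewrite mulrDr.
  rewrite cintegralD; try exact: cintegrable_expzM.
  under [X in _ + X]eq_cintegral do rewrite mulrC.
  rewrite cintegralZ ?cintegral_expz; last exact: cintegrable_expz.
  have [->|n0] := eqVneq n 0; last by rewrite p0// mulr0 addr0.
  by under eq_cintegral do rewrite expr0z mul1r; rewrite mulr1 subrr.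
by apply: filterS => z /eqP; rewrite subr_eq0 => /eqP.
Qed.

End SquareIntegrable.

(** * Unitary-valued analytic functions *)

Section UnitaryFunctions.
Context {R : realType} {K : hilbertType R}.
Local Notation mu := (@circle_measure R).
Implicit Types (x y v w : K) (f g h : circle R -> K) (a : R[i]) (r : R) (n m : int).
Implicit Types (Q P : circle R -> bop K).
Hypothesis sepK : separable K.

Definition unitary_fun Q :=
  (forall v, wmeasurable (fun z => Q z v)) /\ \forall z \ae mu, unitary (Q z).

Lemma unitary_fun_adj Q : unitary_fun Q -> unitary_fun (fun z => adj (Q z)).
Proof.
move=> [mQ uQ]; split; last by apply: filterS uQ => z; exact: unitary_adj.
by move=> v w; under eq_fun do rewrite adjPl dotC; exact/cmeasurableJ/mQ.
Qed.

Lemma wmeasurable_mul Q f : unitary_fun Q -> wmeasurable f -> wmeasurable (fun z => Q z (f z)).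
Proof.
move=> uQ wf w; under eq_fun do rewrite adjP.
by apply: cmeasurable_dot => //; have [+ _] := unitary_fun_adj uQ; exact.
Qed.

Lemma unitary_fun_comp P Q : unitary_fun P -> unitary_fun Q ->
  unitary_fun (fun z => bop_comp (P z) (Q z)).
Proof.
move=> uP uQ; split.
  by move=> v; apply: (wmeasurable_mul uP); case: uQ => + _; exact.
apply: filterS2 uP.2 uQ.2 => z [p1 p2] [q1 q2].
have uPz : unitary (P z) by []. have uQz : unitary (Q z) by [].
have e : adj (bop_comp (P z) (Q z)) = bop_comp (adj (Q z)) (adj (P z)).
  by apply: adjE => x y /=; rewrite !adjP.
by apply: unitaryP => x; rewrite e /= ?(unitaryK uPz) ?(unitaryVK uQz) ?(unitaryK uQz) ?(unitaryVK uPz).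
Qed.

Lemma sqint_mul Q f : unitary_fun Q -> sqint f -> sqint (fun z => Q z (f z)).
Proof.
move=> uQ sf; apply: (@sqint_dom _ _ sepK _ f 1) => //.
  by apply: wmeasurable_mul => //; case: sf.
by apply: filterS uQ.2 => z uz; rewrite unitary_hnorm// mul1r.
Qed.

Lemma wmeasurable_conj f : wmeasurable f -> wmeasurable (fun z => f (circle_conj z)).
Proof.
move=> wf w; have [m1 m2] := wf w.
by split; [exact: (measurableT_comp m1 measurable_circle_conj)|
  exact: (measurableT_comp m2 measurable_circle_conj)].
Qed.

Lemma sqint_conj f : sqint f -> sqint (fun z => f (circle_conj z)).
Proof.
move=> [wf fi]; split; first exact: wmeasurable_conj.
by have [] := integrable_circle_conj fi.
Qed.

Lemma unitary_fun_rho Q : unitary_fun Q -> unitary_fun (rho Q).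
Proof.
move=> uQ; apply: unitary_fun_adj; split; last exact: ae_circle_conj uQ.2.
by move=> v; apply: wmeasurable_conj (fun z => Q z v) _; case: uQ.
Qed.

Lemma rhoK Q : rho (rho Q) = Q.
Proof. by apply/funext => z; rewrite /rho adjK circle_conjK. Qed.

Lemma fcoef_conj f n w : sqint f ->
  fcoef (fun z => f (circle_conj z)) n w = fcoef f (- n) w.
Proof.
move=> sf; rewrite /fcoef -[RHS]cintegral_conj; last first.
  by apply: cintegrable_expzM; exact: cintegrable_dotw.
by apply: eq_cintegral => z; rewrite circle_conj_expz !opprK.
Qed.

Lemma fcoef_adj Q n v w : unitary_fun Q ->
  fcoef (fun z => adj (Q z) v) n w = (fcoef (fun z => Q z w) (- n) v)^*.
Proof.
move=> uQ; rewrite /fcoef -cintegralJ; last first.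
  by apply/cintegrable_expzM/cintegrable_dotw/sqint_mul => //; exact: sqint_cst.
by apply: eq_cintegral => z; rewrite rmorphM /= -circle_expzN opprK adjPl dotC.
Qed.

Lemma fcoef_rho Q n v w : unitary_fun Q ->
  fcoef (fun z => rho Q z v) n w = (fcoef (fun z => Q z w) n v)^*.
Proof.
move=> uQ; have uQ' := unitary_fun_adj uQ.
rewrite (fcoef_conj n w (f := fun z => adj (Q z) v)); last first.
  by apply: (sqint_mul uQ'); exact: sqint_cst.
by rewrite fcoef_adj// opprK.
Qed.

Lemma fourier_coefs_rho Q (Qn : nat -> bop K) : unitary_fun Q ->
  fourier_coefs Q Qn -> fourier_coefs (rho Q) (fun k => adj (Qn k)).
Proof.
move=> uQ QQ k v w; rewrite -/(fcoef _ _ _) fcoef_rho//.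
by rewrite adjPl dotC (QQ k w v).
Qed.

(** What is used of an inner function. As the values are unitary almost
    everywhere, multiplication preserves square-integrability, and membership
    in the images of multiplication operators becomes a matter of
    measurability ([mulop_imageP]). *)
Definition analytic_unitary Q :=
  unitary_fun Q /\ forall f, hardy f -> hardy (fun z => Q z (f z)).

Lemma inner_analytic_unitary Q : inner_function Q -> analytic_unitary Q.
Proof.
move=> [[[bQ _] aQ] uQ].
have u : unitary_fun Q by split=> // v; exact: borel_wmeasurable.
split=> // f hf; apply: aQ; split; last by exists f => //; exact: nearW.
by apply/(L2_sqint sepK)/sqint_mul => //; have /(hardyE sepK)[] := hf.
Qed.

Lemma mulop_imageP Q g : unitary_fun Q -> mulop_image Q hardy g <->
  wmeasurable g /\ exists2 f, hardy f & \forall z \ae mu, g z = Q z (f z).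
Proof.
move=> uQ; split=> [[/(L2_sqint sepK)[wg _] h]//|[wg [f hf gf]]].
split; last by exists f.
apply/(L2_sqint sepK); have /(hardyE sepK)[sf _] := hf.
apply: (@sqint_dom _ _ sepK _ _ 1 wg (sqint_mul uQ sf)).
by apply: filterS gf => z ->; rewrite mul1r.
Qed.

(** The mean of a square-integrable function is represented by a vector by the
    Riesz theorem, with bound the integral of 1 + |f|^2, which exceeds |f|. *)
Lemma mean_exists f : sqint f -> exists u, forall w, dot u w = fcoef f 0 w.
Proof.
move=> sf.
have ci x : cintegrable (fun z => dot x (f z)).
  by apply: cintegrable_dot => //; exact: sqint_cst.
have lphi : linear (fun x => cintegral (fun z => dot x (f z)) : R[i]^o).
  move=> a x y; under eq_cintegral do rewrite dotDl dotZl.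
  by rewrite cintegralD ?cintegralZ//; exact: cintegrableZ.
pose phi : {linear K -> R[i]^o} := HB.pack
  (fun x => cintegral (fun z => dot x (f z)) : R[i]^o)
  (GRing.isLinear.Build _ _ _ _ _ lphi).
have ib : mu.-integrable setT (EFin \o (fun z => 1 + hnorm (f z) ^+ 2)).
  rewrite (_ : _ \o _ = (fun z => (1%:E + (hnorm (f z) ^+ 2)%:E)%E))//.
  by apply: integrableD => //; [exact: finite_measure_integrable_cst|case: sf].
have [u uP] : exists u, forall x, phi x = dot x u.
  apply: (@riesz _ _ phi (\int[mu]_z (1 + hnorm (f z) ^+ 2))) => x /=.
  rewrite -RintegralZr//; apply: le_Rintegral => //; first by case: (ci x).
    rewrite (_ : _ \o _ = (fun z => ((1 + hnorm (f z) ^+ 2)%:E * (hnorm x)%:E)%E))//.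
    exact: integrableZr.
  move=> z _; rewrite (le_trans (Re_dot_le _ _))// mulrC ler_wpM2r ?hnorm_ge0//.
  by have := hnorm_ge0 (f z); nra.
exists u => w; rewrite dotC -uP /= -cintegralJ//.
by apply: eq_cintegral => z; rewrite oppr0 expr0z mul1r -dotC.
Qed.

(** g is (f - c)/z, where c is the mean of f; the subtracted term in the last
    clause is the coefficient of c/z, which cancels that of f/z at -1. *)
Lemma backward_shift f : hardy f -> exists c g,
  [/\ forall w, dot c w = fcoef f 0 w, hardy g,
      forall z, f z = c + val z ^ 1 *: g z &
      forall n w, fcoef g n w = fcoef f (n + 1) w - (n == -1)%:R * fcoef f 0 w].
Proof.
move=> /(hardyE sepK)[sf h]; have [c cP] := mean_exists sf.
pose g z := val z ^ (-1) *: (f z + - c).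
have sc := sqint_cst (- c).
have sff : sqint (fun z => f z + - c) by exact: sqintD.
have sg : sqint g by exact: sqint_expz.
have gE n w : fcoef g n w = fcoef f (n + 1) w - (n == -1)%:R * fcoef f 0 w.
  rewrite fcoef_expz fcoefD// fcoef_cst opprK dotNl cP mulrN.
  by rewrite -[n == -1](inj_eq (addIr 1)) addNr.
exists c, g; split=> //.
- apply/(hardyE sepK); split=> // n w n0; rewrite gE.
  have [->|n1] := eqVneq n (-1); first by rewrite addNr mul1r subrr.
  by rewrite mul0r subr0 h//; move: n0 n1 => /=; lia.
- by move=> z; rewrite scalerA -circle_expzD expr0z scale1r addrC subrK.
Qed.

(** The coefficients of a product are a Cauchy product. Writing f = c + z g
    with g in the Hardy space, Q f = Q c + z Q g, and Q g is again in the
    Hardy space: its coefficient at -1 vanishes, which starts the induction. *)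
Lemma fcoef_mul Q (Qn : nat -> bop K) f (n : nat) w : analytic_unitary Q ->
  fourier_coefs Q Qn -> hardy f ->
  fcoef (fun z => Q z (f z)) n%:Z w = \sum_(k < n.+1) fcoef f k%:Z (adj (Qn (n - k)%N) w).
Proof.
move=> [uQ aQ] QQ.
have QE (k : nat) v : fcoef (fun z => Q z v) k%:Z w = dot (Qn k v) w by rewrite QQ.
have step f1 c g m : hardy g -> (forall z, f1 z = c + val z ^ 1 *: g z) ->
    fcoef (fun z => Q z (f1 z)) m w =
    fcoef (fun z => Q z c) m w + fcoef (fun z => Q z (g z)) (m - 1) w.
  move=> hg fE; have [sg _] := (hardyE sepK g).1 hg.
  have sQg : sqint (fun z => Q z (g z)) by exact: sqint_mul.
  rewrite -fcoef_expz -fcoefD//; last 2 first.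
  - by apply: (sqint_mul uQ); exact: sqint_cst.
  - exact: sqint_expz.
  by congr (fcoef _ m w); apply/funext => z; rewrite fE linearD linearZ.
move=> hf; elim: n f hf => [|n IH] f hf; have [c [g [cP hg fE gE]]] := backward_shift hf.
- rewrite (step _ _ _ _ hg fE) big_ord_recl big_ord0 addr0 /= subn0 QE adjP cP.
  by have /(hardyE sepK)[_ ->//] := aQ g hg; rewrite addr0.
- rewrite (step _ _ _ _ hg fE) big_ord_recl /= subn0 QE adjP cP; congr (_ + _).
  rewrite (_ : n.+1%:Z - 1 = n%:Z); last by lia.
  rewrite IH//; apply: eq_bigr => k _.
  by rewrite /bump /= add1n subSS gE mul0r subr0 -(addn1 k) PoszD.
Qed.

End UnitaryFunctions.

(** * Twisting the coefficients by a constant unitary *)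

Section Twist.
Context {R : realType} {K : hilbertType R}.
Local Notation mu := (@circle_measure R).
Implicit Types (x y v w : K) (f g h : circle R -> K) (a : R[i]) (r : R) (n m : int).
Implicit Types (Q P W : circle R -> bop K) (Qn : nat -> bop K) (U : bop K).
Hypothesis sepK : separable K.

Lemma fcoef_neg_eq0 Q m v w : analytic_unitary Q -> m < 0 ->
  fcoef (fun z => Q z v) m w = 0.
Proof.
move=> [uQ aQ] m0; have /(hardyE sepK)[_] := aQ _ (hardy_cst sepK v).
by apply.
Qed.

Lemma rho_eq_mul Q Qn U : analytic_unitary Q -> fourier_coefs Q Qn ->
  (forall k x, adj (Qn k) x = Qn k (U x)) ->
  \forall z \ae mu, rho Q z = bop_comp (Q z) U.
Proof.
move=> aQ QQ QU; have [uQ _] := aQ; have QQr := fourier_coefs_rho sepK uQ QQ.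
apply: (ae_eq_bop sepK) => v.
apply: (fcoef_uniqueness sepK (f := fun z => rho Q z v)
  (g := fun z => Q z (U v))).
- exact: (sqint_mul sepK (unitary_fun_rho uQ) (sqint_cst v)).
- exact: (sqint_mul sepK uQ (sqint_cst _)).
- move=> [k|k] w.
    by have := QQr k v w; have := QQ k (U v) w; rewrite /fcoef QU => <- <-.
  by rewrite fcoef_rho// !fcoef_neg_eq0// conjC0.
Qed.

Lemma twist_image_eq Q Qn U : analytic_unitary Q -> fourier_coefs Q Qn ->
  unitary U -> (forall k x, adj (Qn k) x = Qn k (U x)) ->
  mulop_image (rho Q) hardy = mulop_image Q hardy.
Proof.
move=> aQ QQ uU QU; have [uQ _] := aQ; have uQr := unitary_fun_rho uQ.
have E := rho_eq_mul aQ QQ QU.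
apply/seteqP; split=> g.
- move=> /(mulop_imageP sepK _ uQr)[wg [f hf gf]].
  apply/(mulop_imageP sepK _ uQ); split=> //.
  exists (fun z => U (f z)); first exact: hardy_bop.
  by apply: filterS2 gf E => z -> ->.
- move=> /(mulop_imageP sepK _ uQ)[wg [f hf gf]].
  apply/(mulop_imageP sepK _ uQr); split=> //.
  exists (fun z => adj U (f z)); first exact: hardy_bop.
  by apply: filterS2 gf E => z -> -> /=; rewrite unitaryVK.
Qed.

(** The coefficients of <W v, w> vanish at negative indices because W v is a
    Hardy function, and at positive ones because (adj W) w is. So <W v, w> is
    almost everywhere constant; letting v and w run through a dense sequence,
    the value of W at a single good point is the constant sought. *)
Lemma bianalytic_constant W : unitary_fun W ->
  (forall v, hardy (fun z => W z v)) -> (forall v, hardy (fun z => adj (W z) v)) ->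
  exists2 U, unitary U & \forall z \ae mu, W z = U.
Proof.
move=> uW hW hW'.
have cst v w : \forall z \ae mu, dot (W z v) w = cintegral (fun z => dot (W z v) w).
  apply: ae_constant.
    by apply: cintegrable_dotw => //; exact: (sqint_mul sepK uW (sqint_cst _)).
  move=> n n0; rewrite -[n]opprK -/(fcoef (fun z => W z v) (- n) w).
  have [n1|n1] := ltP (- n) 0.
    by have /(hardyE sepK)[_ ->] := hW v.
  have -> : (fun z => W z v) = (fun z => adj (adj (W z)) v).
    by apply/funext => z; rewrite adjK.
  rewrite fcoef_adj//; last exact: unitary_fun_adj.
  have /(hardyE sepK)[_ ->] := hW' w; rewrite ?conjC0// opprK.
  by rewrite lt_neqAle n0 -oppr_ge0.
have [d dP] := separable_seq sepK.
have H : \forall z \ae mu, forall k l, dot (W z (d k)) (d l) = cintegral (fun z => dot (W z (d k)) (d l)).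
  by apply/ae_foralln => k; apply/ae_foralln => l; exact: cst.
have [z0 [h0 u0]] := ae_ex (filterI H uW.2).
exists (W z0) => //; apply: filterS H => z h.
apply: (dense_eq_bop dP) => k; apply/eqP; rewrite -subr_eq0; apply/eqP.
by apply: (dense_eq0 dP) => l; rewrite dotBl h h0 subrr.
Qed.

Lemma image_sub_factor Q P v : unitary_fun Q -> unitary_fun P ->
  mulop_image P hardy `<=` mulop_image Q hardy ->
  hardy (fun z => adj (Q z) (P z v)).
Proof.
move=> uQ uP PQ.
have wP := wmeasurable_mul sepK uP (wmeasurable_cst v).
have : mulop_image P hardy (fun z => P z v).
  apply/(mulop_imageP sepK) => //; split => //; exists (fun=> v); first exact: hardy_cst.
  exact: nearW.
move=> /PQ/(mulop_imageP sepK _ uQ)[_ [f hf fP]].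
apply: (ae_hardy sepK _ _ hf); first exact: (wmeasurable_mul sepK (unitary_fun_adj uQ)).
by apply: filterS2 fP uQ.2 => z -> uz; rewrite unitaryK.
Qed.

Lemma image_eq_twist Q Qn : analytic_unitary Q -> fourier_coefs Q Qn ->
  mulop_image (rho Q) hardy = mulop_image Q hardy ->
  exists2 U, unitary U & forall k x, adj (Qn k) x = Qn k (U x).
Proof.
move=> aQ QQ E; have [uQ _] := aQ; have uQr := unitary_fun_rho uQ.
pose W z := bop_comp (adj (Q z)) (rho Q z).
have uW : unitary_fun W by apply: unitary_fun_comp => //; exact: unitary_fun_adj.
have [|v|U uU WU] := bianalytic_constant uW.
- by move=> v; apply: image_sub_factor => //; rewrite E.
- have -> : (fun z => adj (W z) v) = fun z => adj (rho Q z) (Q z v).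
    apply/funext => z; rewrite (_ : adj (W z) = bop_comp (adj (rho Q z)) (Q z))//.
    by apply: adjE => x y /=; rewrite adjPl adjP.
  by apply: image_sub_factor => //; rewrite E.
exists U => // k x; apply: dot_injl => w.
have QQr := fourier_coefs_rho sepK uQ QQ.
rewrite QQr (QQ k (U x) w); apply: ae_fcoef.
- exact: (wmeasurable_mul sepK uQr (wmeasurable_cst _)).
- exact: (wmeasurable_mul sepK uQ (wmeasurable_cst _)).
- by apply: filterS2 WU uQ.2 => z <- uz /=; rewrite unitaryVK.
Qed.

End Twist.

(** * Orthonormal bases *)

Section OrthonormalBasis.
Context {R : realType} {K : hilbertType R}.
Implicit Types (x y v w : K) (a : R[i]) (r : R) (T : bop K).

Definition orthonormal (n : nat) (e : nat -> K) :=
  forall i j, (i < n)%N -> (j < n)%N -> dot (e i) (e j) = (i == j)%:R.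

Definition expands (n : nat) (e : nat -> K) x := x = \sum_(i < n) dot x (e i) *: e i.

Lemma expandsD n e x y : expands n e x -> expands n e y -> expands n e (x + y).
Proof.
rewrite /expands => {1}-> {1}->; rewrite -big_split; apply: eq_bigr => i _.
by rewrite dotDl scalerDl.
Qed.

Lemma expandsZ n e a x : expands n e x -> expands n e (a *: x).
Proof.
rewrite /expands => {1}->; rewrite scaler_sumr; apply: eq_bigr => i _.
by rewrite dotZl scalerA.
Qed.

Lemma dot_suml (I : Type) (s : seq I) (F : I -> K) y :
  dot (\sum_(i <- s) F i) y = \sum_(i <- s) dot (F i) y.
Proof. by elim/big_rec2: _ => [|i u v _ <-]; rewrite ?dot0l ?dotDl. Qed.

Lemma gram_schmidt (s : seq K) : exists n e, orthonormal n e /\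
  forall x, x \in s -> expands n e x.
Proof.
elim: s => [|y s [n [e [on sp]]]]; first by exists 0%N, (fun=> 0).
pose r := y - \sum_(i < n) dot y (e i) *: e i.
have re i : (i < n)%N -> dot r (e i) = 0.
  move=> ni; rewrite dotBl dot_suml (bigD1 (Ordinal ni))//= dotZl on// eqxx mulr1.
  rewrite big1 ?addr0 ?subrr// => j ji; rewrite dotZl on//.
  by rewrite (_ : (j == i :> nat) = false) ?mulr0//; apply/negbTE.
have [r0|r0] := eqVneq r 0.
  exists n, e; split=> // x; rewrite in_cons => /predU1P[->|]; last exact: sp.
  by move/eqP: r0; rewrite subr_eq0 => /eqP.
have rp : 0 < hnorm r.
  by rewrite lt_neqAle hnorm_ge0 andbT eq_sym; apply/eqP => /hnorm_eq0/eqP; exact/negP.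
pose u := ((hnorm r)^-1)%:C *: r.
have uu : dot u u = 1.
  rewrite dotZl dotZr conj_realC dotxx -!rmorphM /=.
  by rewrite (_ : _ * _ = 1)//; field; rewrite gt_eqF.
have ue i : (i < n)%N -> dot u (e i) = 0 by move=> ni; rewrite dotZl re// mulr0.
have eu i : (i < n)%N -> dot (e i) u = 0 by move=> ni; rewrite dotC ue// conjC0.
pose e' k := if (k < n)%N then e k else u.
have e'e k : (k < n)%N -> e' k = e k by rewrite /e' => ->.
have e'n : e' n = u by rewrite /e' ltnn.
have sumE x : \sum_(i < n.+1) dot x (e' i) *: e' i =
    \sum_(i < n) dot x (e i) *: e i + dot x u *: u.
  by rewrite big_ord_recr /= e'n; congr (_ + _); apply: eq_bigr => i _; rewrite e'e.
exists n.+1, e'; split.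
  move=> i j; rewrite !ltnS (leq_eqVlt i) (leq_eqVlt j).
  move=> /predU1P[->|ni] /predU1P[->|nj].
  - by rewrite e'n uu eqxx.
  - by rewrite e'n e'e// ue// gtn_eqF.
  - by rewrite e'n e'e// eu// ltn_eqF.
  - by rewrite !e'e// on.
move=> x; rewrite in_cons => /predU1P[->|xs]; rewrite /expands sumE.
- have yE : y = \sum_(i < n) dot y (e i) *: e i + r by rewrite addrC subrK.
  rewrite {1}yE; congr (_ + _); rewrite {1}yE dotDl dot_suml big1 ?add0r.
    rewrite /u dotZr conj_realC dotxx scalerA -!rmorphM /= (_ : _ * _ = 1) ?scale1r//.
    by field; rewrite gt_eqF.
  by move=> i _; rewrite dotZl eu ?mulr0.
- have xE := sp x xs; rewrite -xE {3}xE dot_suml big1 ?scale0r ?addr0//.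
  by move=> i _; rewrite dotZl eu ?mulr0.
Qed.

Lemma orthonormal_basis : finite_dimensional K -> exists n e, orthonormal n e /\ forall x, expands n e x.
Proof.
move=> [m [b bP]]; have [n [e [on sp]]] := gram_schmidt [seq b i | i <- enum 'I_m].
exists n, e; split=> // x; have [c ->] := bP x.
elim/big_rec: _ => [|i y _ ey].
  by rewrite /expands big1// => i _; rewrite dot0l scale0r.
by apply: expandsD => //; apply/expandsZ/sp/map_f; rewrite mem_enum.
Qed.

Lemma parseval n e y : (forall x, expands n e x) ->
  dot y y = \sum_(i < n) dot y (e i) * (dot y (e i))^*.
Proof.
move=> sp; rewrite {1}(sp y) dot_suml; apply: eq_bigr => i _.
by rewrite dotZl; congr (_ * _); rewrite dotC.
Qed.

(** Both sides are the sum of the squared moduli of the matrix entries. *)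
Lemma hilbert_schmidt_adj n e T : (forall x, expands n e x) ->
  \sum_(i < n) hnorm (adj T (e i)) ^+ 2 = \sum_(i < n) hnorm (T (e i)) ^+ 2.
Proof.
move=> sp; apply: (@complexI R); rewrite !rmorph_sum /=.
under eq_bigr do rewrite -dotxx (parseval _ sp).
under [RHS]eq_bigr do rewrite -dotxx (parseval _ sp).
rewrite exchange_big /=; apply: eq_bigr => i _; apply: eq_bigr => j _.
by rewrite adjPl mulrC -dotC [X in _ * X = _]dotC.
Qed.

End OrthonormalBasis.

(** * The finite-dimensional case *)

Section FiniteDimensional.
Context {R : realType} {K : hilbertType R}.
Local Notation mu := (@circle_measure R).
Implicit Types (x y v w : K) (f g h : circle R -> K) (a : R[i]) (r : R) (n m : int).
Implicit Types (Q P W : circle R -> bop K) (Qn : nat -> bop K) (U : bop K).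
Hypothesis sepK : separable K.

Lemma variance f q : sqint f -> (forall w, fcoef f 0 w = dot q w) ->
  \int[mu]_z (hnorm (f z - q) ^+ 2) = \int[mu]_z (hnorm (f z) ^+ 2) - hnorm q ^+ 2.
Proof.
move=> sf fq.
have i1 : mu.-integrable setT (EFin \o (fun z => hnorm (f z) ^+ 2)) by case: sf.
have [i2 _] := cintegrable_dotw sepK q sf.
have i3 : mu.-integrable setT (EFin \o (fun z => 2 * Re (dot (f z) q))).
  rewrite (_ : _ \o _ = (fun z => (2%:E * (Re (dot (f z) q))%:E)%E))//.
  exact: integrableZl.
have i4 : mu.-integrable setT (EFin \o (fun z => hnorm (f z) ^+ 2 - 2 * Re (dot (f z) q))).
  exact: (integrableB measurableT i1 i3).
under eq_Rintegral do rewrite sqr_hnormB.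
rewrite RintegralD//; last exact: finite_measure_integrable_cst.
rewrite RintegralB// RintegralZl// Rintegral_cst//= probability_setT mulr1.
have -> : \int[mu]_z Re (dot (f z) q) = hnorm q ^+ 2.
  rewrite sqr_hnorm -fq /fcoef /=.
  by under [RHS]eq_Rintegral do rewrite oppr0 expr0z mul1r.
lra.
Qed.

Lemma Rintegral_eq0_ae (p : circle R -> R) : mu.-integrable setT (EFin \o p) ->
  (forall z, 0 <= p z) -> \int[mu]_z p z = 0 -> \forall z \ae mu, p z = 0.
Proof.
move=> ip p0 I0.
have h : (\int[mu]_z `|(EFin \o p) z| = 0)%E.
  under eq_integral do rewrite /= ger0_norm//.
  by rewrite -[LHS]fineK ?integrable_fin_num// -/(Rintegral _ _ _) I0.
have := (ae_eq_integral_abs mu measurableT (measurable_int _ ip)).1 h.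
by apply: filterS => z /(_ Logic.I)[].
Qed.

(** For W = (adj Q) Q~, which maps constants into the Hardy space, strong
    induction on k shows that (adj W)(adj Q_k) is almost everywhere equal to
    Q_k. *)
Lemma image_sub_twist Q Qn : finite_dimensional K -> analytic_unitary Q ->
  fourier_coefs Q Qn -> mulop_image (rho Q) hardy `<=` mulop_image Q hardy ->
  exists2 U, unitary U & forall k x, adj (Qn k) x = Qn k (U x).
Proof.
move=> fdK aQ QQ sub; have [uQ _] := aQ; have uQr := unitary_fun_rho uQ.
have QQr := fourier_coefs_rho sepK uQ QQ.
have [d [e [on sp]]] := orthonormal_basis fdK.
pose W z := bop_comp (adj (Q z)) (rho Q z).
have uW : unitary_fun W by apply: unitary_fun_comp => //; exact: unitary_fun_adj.
have uW' := unitary_fun_adj uW.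
have hW v : hardy (fun z => W z v) by exact: image_sub_factor.
have key k : forall x, \forall z \ae mu, adj (W z) (adj (Qn k) x) = Qn k x.
  elim/ltn_ind: k => k IH.
  (* Coefficient k of Q~ v = Q W v, as a Cauchy product: by the induction
     hypothesis the term with Q_(k-j), j > 0, is the integral of z^(-j) times a
     constant, so only the one involving the mean of W v is left. *)
  have A v w : dot (adj (Qn k) v) w = fcoef (fun z => W z v) 0 (adj (Qn k) w).
    rewrite QQr -/(fcoef (fun z => rho Q z v) k%:Z w).
    rewrite (@ae_fcoef _ _ _ (fun z => Q z (W z v))); last 3 first.
    - exact: (wmeasurable_mul sepK uQr (wmeasurable_cst v)).
    - exact: (wmeasurable_mul sepK uQ (wmeasurable_mul sepK uW (wmeasurable_cst v))).
    - by apply: filterS uQ.2 => z uz /=; rewrite unitaryVK.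
    rewrite (fcoef_mul sepK _ _ aQ QQ (hW v)) big_ord_recl /= subn0 big1 ?addr0// => j _.
    rewrite /bump /= add1n.
    have jk : (k - j.+1 < k)%N by case: (k) j => [[]//|k' j]; rewrite subSS ltnS leq_subr.
    have -> : fcoef (fun z => W z v) j.+1 (adj (Qn (k - j.+1)%N) w) =
        fcoef (fun=> v) j.+1 (Qn (k - j.+1)%N w).
      apply: ae_eq_cintegral.
      + by apply: cmeasurableM; [exact: cmeasurable_expz|exact: uW.1].
      + by apply: cmeasurableM; [exact: cmeasurable_expz|exact: wmeasurable_cst].
      + by apply: filterS (IH _ jk w) => z h; rewrite adjP h.
    by rewrite fcoef_cst mul0r.
  pose F x z := adj (W z) (adj (Qn k) x).
  have sF x : sqint (F x) by exact: (sqint_mul sepK uW' (sqint_cst _)).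
  (* The mean of F x is Q_k x, so |adj Q_k x|^2 - |Q_k x|^2 is the variance of
     F x, and these variances sum to 0 over the basis. *)
  have mF x w : fcoef (F x) 0 w = dot (Qn k x) w.
    rewrite (fcoef_adj sepK _ _ _ uW) oppr0 -A.
    by rewrite -dotC -adjP.
  have IF x : \int[mu]_z (hnorm (F x z) ^+ 2) = hnorm (adj (Qn k) x) ^+ 2.
    rewrite -[RHS]mulr1 -[X in _ * X](_ : fine (mu setT) = 1); last by rewrite probability_setT.
    rewrite -Rintegral_cst// /Rintegral; congr fine; apply: ae_eq_integral => //.
      by have [_ /measurable_int] := sF x.
    by apply: filterS uW'.2 => z uz _; rewrite /F unitary_hnorm.
  have VF x := variance (sF x) (mF x).
  have V0 x : 0 <= hnorm (adj (Qn k) x) ^+ 2 - hnorm (Qn k x) ^+ 2.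
    by rewrite -IF -VF; apply: Rintegral_ge0 => z _; exact: sqr_ge0.
  have sum0 : \sum_(i < d) (hnorm (adj (Qn k) (e i)) ^+ 2 - hnorm (Qn k (e i)) ^+ 2) = 0.
    by rewrite big_split /= sumrN hilbert_schmidt_adj// subrr.
  have ae_e (i : 'I_d) : \forall z \ae mu, F (e i) z = Qn k (e i).
    have Vi : \int[mu]_z (hnorm (F (e i) z - Qn k (e i)) ^+ 2) = 0.
      rewrite VF IF; by apply: (psumr_eq0P (P := xpredT) (fun (j : 'I_d) _ => V0 (e j)) sum0).
    have sd : sqint (fun z => F (e i) z - Qn k (e i)).
      by apply: sqintD => //; exact: sqint_cst.
    have [_ id] := sd.
    have := Rintegral_eq0_ae id (fun z => sqr_ge0 _) Vi.
    by apply: filterS => z /eqP; rewrite sqrf_eq0 => /eqP/hnorm_eq0/eqP; rewrite subr_eq0 => /eqP.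
  move=> x.
  have : \forall z \ae mu, forall i : nat, (i < d)%N -> F (e i) z = Qn k (e i).
    apply/ae_foralln => i; have [id|id] := ltnP i d; last by apply: nearW.
    by apply: filterS (ae_e (Ordinal id)) => z.
  apply: filterS => z h; rewrite (sp x) !linear_sum; apply: eq_bigr => i _.
  by rewrite !linearZ /= -/(F (e i) z) h.
have : \forall z \ae mu, forall k, bop_comp (adj (W z)) (adj (Qn k)) = Qn k.
  by apply/ae_foralln => k; apply: (ae_eq_bop sepK) => v; exact: key.
move=> /(filterI uW.2)/ae_ex[z0 [u0 h0]].
exists (W z0) => //; move: (W z0) u0 h0 => U u0 h0 k x.
apply: dot_inj => y; rewrite -adjP.
by rewrite -[in LHS](h0 k) /= adjPl adjPl.
Qed.

Lemma cintegral_sum (d : nat) (G : nat -> circle R -> R[i]) :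
  (forall j, cintegrable (G j)) ->
  cintegral (fun z => \sum_(j < d) G j z) = \sum_(j < d) cintegral (G j).
Proof.
move=> iG; have iS k : cintegrable (fun z => \sum_(j < k) G j z).
  elim: k => [|k IH]; first by under eq_fun do rewrite big_ord0; exact: cintegrable_cst.
  by under eq_fun do rewrite big_ord_recr; exact: cintegrableD.
elim: d => [|k IH]; first by under eq_cintegral do rewrite big_ord0; rewrite big_ord0 cintegral_cst.
by under eq_cintegral do rewrite big_ord_recr; rewrite cintegralD// IH big_ord_recr.
Qed.

(** In coordinates <rho Q f, w> is the sum of the
    <f, e_j> conj <Q(conj z) w, e_j>. Applying z |-> conj z and conjugating
    turns the j-th summand into <Q (p_j w), e_j>, where
    p_j(z) = conj <f(conj z), e_j> is a scalar Hardy function, so that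
    Q (p_j w) is a Hardy function. *)
Lemma analytic_unitary_rho Q : finite_dimensional K -> analytic_unitary Q ->
  analytic_unitary (rho Q).
Proof.
move=> fdK [uQ aQ]; have uQr := unitary_fun_rho uQ; split=> // f hf.
have [sf f0] := (hardyE sepK f).1 hf.
apply/(hardyE sepK); split; first exact: sqint_mul.
move=> m w m0.
have [d [e [on sp]]] := orthonormal_basis fdK.
have sfc := sqint_conj sf.
pose p j z := (dot (f (circle_conj z)) (e j))^*.
have mp j : cmeasurable (p j) by apply: cmeasurableJ; exact: (wmeasurable_conj sf.1).
have hp j : hardy (fun z => p j z *: w).
  apply/(hardyE sepK); split.
    apply: (@sqint_dom _ _ sepK _ _ (2 * hnorm (e j) * hnorm w) _ sfc).
      exact: (wmeasurableZ (mp j) (wmeasurable_cst w)).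
    apply: nearW => z; rewrite hnormZ mulrAC ler_wpM2r ?hnorm_ge0//.
    rewrite /p norm_conjC (le_trans (Re_normc_le _))//.
    have := Re_dot_norm (f (circle_conj z)) (e j); have := Im_dot_norm (f (circle_conj z)) (e j).
    lra.
  move=> n v n0; rewrite /fcoef.
  under eq_cintegral do rewrite dotZl mulrA mulrC.
  rewrite cintegralZ; last first.
    by apply/cintegrable_expzM/cintegrableJ; exact: cintegrable_dotw.
  suff -> : cintegral (fun z => val z ^ (- n) * p j z) = (fcoef f n (e j))^*.
    by rewrite f0// conjC0 mulr0.
  rewrite -[in RHS](opprK n) -fcoef_conj// /fcoef -cintegralJ; last first.
    by apply: cintegrable_expzM; exact: cintegrable_dotw.
  by apply: eq_cintegral => z; rewrite rmorphM /= -circle_expzN !opprK.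
pose G j z := val z ^ (- m) * dot (Q z (p j z *: w)) (e j).
have hQ j := (hardyE sepK _).1 (aQ _ (hp j)).
have iG j : cintegrable (G j).
  by apply: cintegrable_expzM; apply: cintegrable_dotw => //; have [] := hQ j.
rewrite /fcoef.
transitivity (cintegral (fun z => \sum_(j < d) (G j (circle_conj z))^*)).
  apply: eq_cintegral => z; rewrite adjPl {1}(sp (f z)) dot_suml mulr_sumr.
  apply: eq_bigr => j _; rewrite /G /p circle_conjK linearZ /= !dotZl !rmorphM /= conjCK.
  rewrite circle_conj_expz opprK -circle_expzN; congr (_ * (_ * _)).
  by rewrite dotC.
rewrite (@cintegral_sum d (fun j z => (G j (circle_conj z))^*)); last first.
  by move=> j; apply: cintegrableJ; exact: cintegrable_conj.
rewrite big1// => j _; rewrite cintegralJ; last exact: cintegrable_conj.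
rewrite cintegral_conj// -/(fcoef _ _ _).
by have [_ ->//] := hQ j; rewrite conjC0.
Qed.

End FiniteDimensional.

(** * The theorem *)

Theorem theorem7p10 (R : realType) (K : hilbertType R) (hK : separable K)
    (Q : circle R -> bop K) (hQ : inner_function Q)
    (Qn : nat -> bop K) (hQn : fourier_coefs Q Qn) :
  let i := mulop_image (rho Q) hardy = mulop_image Q hardy in
  let ii := exists2 A : bop K, unitary A &
    forall n, bop_comp A (Qn n) = bop_comp (Qn n) A /\
              bop_comp (Qn n) A = adj (bop_comp A (Qn n)) in
  let iii := mulop_image (rho Q) hardy `<=` mulop_image Q hardy in
  let iv := mulop_image Q hardy `<=` mulop_image (rho Q) hardy in
  (i <-> ii) /\
  (finite_dimensional K -> (i <-> iii) /\ (i <-> iv)).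
Proof.
move=> i ii iii iv; have aQ := inner_analytic_unitary hK hQ.
have twist : (exists2 U : bop K, unitary U & forall n x, adj (Qn n) x = Qn n (U x)) -> i.
  by move=> [U uU QU]; exact: (twist_image_eq hK aQ hQn uU QU).
split.
  split=> [/(image_eq_twist hK aQ hQn)/selfadjoint_twist//|/selfadjoint_twist].
  exact: twist.
move=> fdK; split; (split; first by rewrite /i /iii /iv => ->).
  by move=> /(image_sub_twist hK fdK aQ hQn)/twist.
rewrite /iv -{1}(rhoK Q) => sub.
have aQr := analytic_unitary_rho hK fdK aQ.
have QQr := fourier_coefs_rho hK aQ.1 hQn.
have [U uU QU] := image_sub_twist hK fdK aQr QQr sub.
apply: twist; exists (adj U) => [|n x]; first exact: unitary_adj.
by rewrite -[x in LHS](unitaryVK uU) -QU adjK.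
Qed.
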